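(* Let $\gamma$ be the restriction to $\mathbb S_+^d$ of a norm on $\mathbb S^d$, and let $\mu=\mathcal N(m_0,\Sigma_0)$ and $\nu=\mathcal N(m_1,\Sigma_1)$ be Gaussian measures on $\mathbb R^d$. Then $$\mathsf W_\gamma(\mu,\nu)^2=\inf_{K}\ \gamma\left((m_1-m_0)(m_1-m_0)^\top+\Sigma_0+\Sigma_1-K-K^\top\right),$$ where the infimum runs over all $K\in\mathbb R^{d\times d}$ such that $\begin{pmatrix} \Sigma_0 & K \\ {K}^\top & \Sigma_1 \end{pmatrix}\succeq0$.
   Context: $\mathbb S^d$ is the space of real symmetric $d\times d$ matrices and $\mathbb S_+^d$ the cone of positive semidefinite ones; $A\succeq0$ means $A$ is symmetric positive semidefinite. $\mathcal N(m,\Sigma)$ is the Gaussian law with mean $m\in\mathbb R^d$ and covariance $\Sigma\in\mathbb S_+^d$. The static Spectral Wasserstein cost is $\mathsf W_\gamma(\mu,\nu)^2=\inf_{\pi\in\Pi(\mu,\nu)}\gamma\left(\int (y-x)(y-x)^\top\,d\pi(x,y)\right)$, where $\Pi(\mu,\nu)$ is the set of couplings of $\mu$ and $\nu$. *)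

(* Defs.v *)
From HB Require Import structures.
From mathcomp Require Import all_boot all_order all_algebra.
From mathcomp Require Import all_classical all_reals all_analysis.
Set Implicit Arguments.
Unset Strict Implicit.
Unset Printing Implicit Defensive.
Import Order.TTheory GRing.Theory Num.Theory.
Import numFieldNormedType.Exports.
Local Open Scope classical_set_scope.
Local Open Scope ring_scope.

(* R^d as a measurable space: the coordinate (product) sigma-algebra of
   [d.-tuple], which is the Borel one. Linear algebra is done on ['cV[R]_d]. *)
Definition vecspace (R : realType) (d : nat) := d.-tuple (measurableTypeR R).

Definition colv (R : realType) (d : nat) (x : vecspace R d) : 'cV[R]_d :=
  \col_i tnth x i.

Definition psd (R : realType) (n : nat) (A : 'M[R]_n) : Prop :=
  A^T = A /\ forall v : 'cV[R]_n, 0 <= (v^T *m A *m v) 0 0.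

Definition sym_norm (R : realType) (d : nat) (N : 'M[R]_d -> R) : Prop :=
  [/\ forall A B : 'M[R]_d, A^T = A -> B^T = B -> N (A + B) <= N A + N B,
      forall (c : R) (A : 'M[R]_d), A^T = A -> N (c *: A) = `|c| * N A
    & forall A : 'M[R]_d, A^T = A -> N A = 0 -> A = 0].

(* Only the values of [gamma] on the positive semidefinite cone matter. *)
Definition psd_restriction_of_norm (R : realType) (d : nat)
    (gamma : 'M[R]_d -> R) : Prop :=
  exists2 N : 'M[R]_d -> R, sym_norm N & forall A, psd A -> gamma A = N A.

(* The law N(a, v) on R with variance [v]. The case [v = 0] is separate because
   [normal_prob a 0] is by convention the uniform law on [0, 1]. *)
Definition normal_law (R : realType) (a v : R) :
    set (measurableTypeR R) -> \bar R :=
  if v == 0 then dirac a else normal_prob a (Num.sqrt v).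

(* N(m, Sigma), possibly degenerate: for every u the linear form x |-> <u, x>
   has law N(<u, m>, u^T Sigma u). *)
Definition gaussian (R : realType) (d : nat)
    (mu : probability (vecspace R d) R) (m : 'cV[R]_d) (Sigma : 'M[R]_d) : Prop :=
  forall (u : 'cV[R]_d) (A : set (measurableTypeR R)), measurable A ->
    pushforward mu (fun x => (u^T *m colv x) 0 0 : measurableTypeR R) A
    = normal_law ((u^T *m m) 0 0) ((u^T *m Sigma *m u) 0 0) A.

Definition couplings (R : realType) (d : nat)
    (mu nu : probability (vecspace R d) R) :
    set (probability (vecspace R d * vecspace R d)%type R) :=
  [set pi | (forall A, measurable A -> pushforward pi fst A = mu A) /\
            (forall B, measurable B -> pushforward pi snd B = nu B)].

Definition displacement_mx (R : realType) (d : nat)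
    (pi : probability (vecspace R d * vecspace R d)%type R) : 'M[R]_d :=
  \matrix_(i, j) \int[pi]_z
    ((colv z.2 - colv z.1) *m (colv z.2 - colv z.1)^T) i j.

(* Meant for [mu] and [nu] with finite second moments, so that the entries of
   [displacement_mx] are integrals of integrable functions. The set of costs is
   nonempty (product coupling), and bounded below by 0 for [gamma] as above. *)
Definition spectralW (R : realType) (d : nat) (gamma : 'M[R]_d -> R)
    (mu nu : probability (vecspace R d) R) : R :=
  Num.sqrt (inf [set gamma (displacement_mx pi) | pi in couplings mu nu]).

(* Main.v *)
Require Import Defs.
From HB Require Import structures.
From mathcomp Require Import all_boot all_order all_algebra.
From mathcomp Require Import all_classical all_reals all_analysis.
From mathcomp Require Import measurable_realfun.
From mathcomp Require Import ring lra.
Set Implicit Arguments.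
Unset Strict Implicit.
Unset Printing Implicit Defensive.
Import Order.TTheory GRing.Theory Num.Theory.
Import numFieldNormedType.Exports.
Local Open Scope classical_set_scope.
Local Open Scope ring_scope.

(** The two infima are taken over the same set of values, because the
    displacement matrix of a coupling depends only on the two Gaussian marginals
    and on the cross-covariance K of the coupling, and because the possible K are
    exactly those that make the block matrix positive semidefinite.

    Every coupling gives an admissible K ([coupling_displacement]). The pair
    (x, y) is square integrable since its marginals are, its means and its
    diagonal covariance blocks are those of the marginals, and a covariance matrix
    is positive semidefinite ([psd_covariance]). Expanding the second moment of
    y - x gives the matrix in the statement ([difference_block]).

    Every admissible K comes from a coupling ([displacement_coupling]): split a
    Gaussian vector of dimension d + d with the prescribed block covariance into
    its two halves. It exists because a positive semidefinite matrix is a sum of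
    rank one matrices b b^T ([psd_sum_rank1]), each realized by an independent
    standard normal multiple of b ([gaussian_exists]). Its halves are Gaussian
    with the parameters of mu and nu; to conclude that they are mu and nu one
    needs that a Gaussian law is determined by its mean and covariance
    ([gaussian_unique]).

    Here a Gaussian law is known only through the laws of the linear forms, so
    this uniqueness is a Cramer-Wold theorem ([eq_probability_of_cos]). It is
    proved without Fourier inversion: the functions cos (<u, x> + c) span an
    algebra, and polynomials in them converge boundedly to indicators of
    intersections of half-spaces, which form a generating pi-system.

    Everything about normal laws goes through the single formula
      E cos (t X + c) = cos (t a + c) exp (- v t^2 / 2)
    for X normal of mean a and variance v ([integral_cos_normal_law]), which also holds
    for v = 0. It characterizes Gaussian vectors ([gaussianP]), turns sums of
    independent normals into products of exponentials, and yields the first two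
    moments by letting t tend to 0 ([Rintegral_of_cos], [Rintegral_sqr_of_cos]).

    Finally the square of the square root is the infimum itself, because the costs
    are nonnegative: a displacement matrix is positive semidefinite and a norm
    satisfies 0 = N 0 <= N D + N (- D) = 2 N D. *)

(** * Integrals against a probability *)

Section IntegralTools.
Context d (T : measurableType d) (R : realType).

Lemma bounded_integrable (P : probability T R) (f : T -> R) (M : R) :
  measurable_fun [set: T] f -> (forall x, `|f x| <= M) ->
  P.-integrable [set: T] (EFin \o f).
Proof.
move=> mf fM; apply: measurable_bounded_integrable => //.
  by rewrite [ltLHS]probability_setT ltry.
exists M; split; first exact: num_real.
by move=> y My x _; exact: le_trans (fM x) (ltW My).
Qed.

(** Real-valued form of dominated convergence. The limit is measurable and
    dominated as well, so its integral is finite and [fine] may be applied to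
    the convergence of the extended integrals. *)
Lemma dominated_cvg_Rintegral (mu : {measure set T -> \bar R})
    (f_ : nat -> T -> R) (f g : T -> R) :
  (forall n, measurable_fun [set: T] (f_ n)) ->
  mu.-integrable [set: T] (EFin \o g) ->
  (forall n x, `|f_ n x| <= g x) ->
  (forall x, f_ ^~ x @ \oo --> f x) ->
  \int[mu]_x f_ n x @[n --> \oo] --> \int[mu]_x f x.
Proof.
move=> mf ig fg ff.
have cvE x : [set: T] x -> (EFin \o f_ ^~ x) @ \oo --> (f x)%:E.
  by move=> _; apply: cvg_EFin; [exact: nearW|exact: ff].
have mfE n : measurable_fun [set: T] (fun x => (f_ n x)%:E) by exact/measurable_EFinP.
have fgE n x : [set: T] x -> (`|(EFin \o f_ n) x| <= (EFin \o g) x)%E.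
  by move=> _; rewrite lee_fin fg.
have gE x : [set: T] x -> (EFin \o g) x \is a fin_num by [].
have := @dominated_cvg _ _ _ mu _ measurableT (fun n => EFin \o f_ n) _ _
  mfE cvE gE ig fgE.
move=> cI; apply: fine_cvg; rewrite fineK//.
apply: integrable_fin_num => //.
apply: le_integrable ig => //.
  exact: (emeasurable_fun_cvg _ _ mfE cvE).
move=> x _; rewrite lee_fin [leRHS]ger0_norm; last exact: le_trans (fg 0%N x).
have cn : `|f_ n x| @[n --> \oo] --> `|f x| by apply: cvg_norm; exact: ff.
rewrite -(cvg_lim _ cn)//; apply: limr_le; first by apply/cvg_ex; exists `|f x|.
by apply: nearW => n; exact: fg.
Qed.

End IntegralTools.

Section CosBounded.
Context d (T : measurableType d) (R : realType).

Lemma measurable_cos_fun (f : T -> R) : measurable_fun [set: T] f ->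
  measurable_fun [set: T] (fun x => cos (f x)).
Proof.
move=> mf; apply: (measurableT_comp (f := @cos R)) => //.
by apply: continuous_measurable_fun; exact: continuous_cos.
Qed.

Lemma integrable_cos (P : probability T R) (f : T -> R) :
  measurable_fun [set: T] f -> P.-integrable [set: T] (EFin \o (fun x => cos (f x))).
Proof.
move=> mf; apply: (@bounded_integrable _ _ _ P _ 1).
  exact: measurable_cos_fun.
by move=> x; exact: cos_max.
Qed.

End CosBounded.

Section ImageProbability.
Context d1 d2 (T1 : measurableType d1) (T2 : measurableType d2) (R : realType).

(** The law of [f] under [P]. The measurability of [f] is an argument, so that
    laws of explicitly written maps need no packaging as random variables. *)
Definition image_prob (f : T1 -> T2) (mf : measurable_fun [set: T1] f)
    (P : probability T1 R) : probability T2 R :=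
  distribution P (mfun_Sub (mem_set mf) : {mfun T1 >-> T2}).

Lemma Rintegral_image_prob f mf (P : probability T1 R) (g : T2 -> R) :
  measurable_fun [set: T2] g -> P.-integrable [set: T1] (EFin \o (g \o f)) ->
  \int[@image_prob f mf P]_y g y = \int[P]_x g (f x).
Proof.
move=> mg ig; congr fine.
by apply: (integral_pushforward mf) => //; exact/measurable_EFinP.
Qed.

Lemma eq_probability_Rintegral (P Q : probability T1 R) (g : T1 -> R) :
  (forall A, measurable A -> P A = Q A) -> \int[P]_x g x = \int[Q]_x g x.
Proof. by move=> e; congr fine; apply: eq_measure_integral => A mA _; exact: e. Qed.

Lemma eq_probability_integrable (P Q : probability T1 R) (g : T1 -> R) :
  (forall A, measurable A -> P A = Q A) ->
  P.-integrable [set: T1] (EFin \o g) -> Q.-integrable [set: T1] (EFin \o g).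
Proof.
move=> e /integrableP[mg ig]; apply/integrableP; split => //.
rewrite (_ : (\int[Q]_x _)%E = (\int[P]_x `|(EFin \o g) x|)%E)//.
by apply: eq_measure_integral => A mA _; exact/esym/e.
Qed.

End ImageProbability.

Section CouplingMarginals.
Context d1 d2 (T1 : measurableType d1) (T2 : measurableType d2) (R : realType).

(** Transfers integrability from a marginal [Q] of [P] back to [P]. Integrability
    under [P] is to be proved, so the change of variables is done
    on absolute values, where it holds unconditionally. *)
Lemma integrable_preimage (P : probability T1 R) (Q : probability T2 R)
    (f : T1 -> T2) (g : T2 -> R) :
  measurable_fun [set: T1] f -> measurable_fun [set: T2] g ->
  (forall A, measurable A -> P (f @^-1` A) = Q A) ->
  Q.-integrable [set: T2] (EFin \o g) ->
  P.-integrable [set: T1] (EFin \o (g \o f)) /\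
  \int[P]_x g (f x) = \int[Q]_y g y.
Proof.
move=> mf mg e iQ.
have e' A : measurable A -> Q A = image_prob mf P A by move=> mA; rewrite -e.
have iI := eq_probability_integrable e' iQ.
have iP : P.-integrable [set: T1] (EFin \o (g \o f)).
  apply/integrableP; split.
    by apply/measurable_EFinP; exact: measurableT_comp.
  have /integrableP[_] := iI; apply: le_lt_trans.
  rewrite le_eqVlt; apply/orP; left; apply/eqP/esym.
  rewrite [LHS](ge0_integral_pushforward mf)//.
  by apply: measurableT_comp => //; exact/measurable_EFinP.
split => //; rewrite (eq_probability_Rintegral g e').
by rewrite Rintegral_image_prob.
Qed.

End CouplingMarginals.

(** * Polynomials approximating a step *)

Lemma bernoulli_inequality (R : realDomainType) (x : R) n :
  -1 <= x -> 1 + n%:R * x <= (1 + x) ^+ n.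
Proof.
move=> x1; elim: n => [|n IH]; first by rewrite mul0r addr0 expr0.
have x0 : 0 <= 1 + x by lra.
rewrite exprSr; apply: le_trans (ler_wpM2r x0 IH).
rewrite -natr1; have := sqr_ge0 x; have : 0 <= n%:R :> R by [].
nra.
Qed.

(** With w = sqrt z, the factor w ^ n absorbs n by the Bernoulli inequality
    applied to 1 / w, and a second factor w ^ n tends to 0. *)
Lemma cvg_natM_expr (R : realType) (z : R) :
  0 <= z < 1 -> n%:R * z ^+ n @[n --> \oo] --> 0.
Proof.
move=> /andP[z0 z1].
have [->|zn0] := eqVneq z 0.
  apply: cvg_near_cst; near=> n.
  rewrite expr0n; case: eqP => [->|_]; rewrite ?mul0r ?mulr0//.
have zp : 0 < z by rewrite lt_def zn0.
pose w := Num.sqrt z.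
have w0 : 0 < w by rewrite sqrtr_gt0.
have zw : z = w * w by rewrite -expr2 sqr_sqrtr.
have w1 : w < 1 by rewrite ltNge; apply/negP => h; nra.
pose h := w^-1 - 1.
have h0 : 0 < h by rewrite subr_gt0 invf_gt1.
have nwn n : n%:R * w ^+ n <= h^-1.
  have H : n%:R * h <= (w ^+ n)^-1.
    rewrite -exprVn.
    have -> : w^-1 = 1 + h by rewrite /h; ring.
    have h1 : -1 <= h by lra.
    by apply: le_trans (bernoulli_inequality n h1); rewrite ler_wpDl.
  rewrite -[leRHS]mul1r ler_pdivlMr//.
  by rewrite mulrAC -ler_pdivlMr ?exprn_gt0// mul1r.
have wg : h^-1 * w ^+ n @[n --> \oo] --> 0.
  by apply: (@cvg_geometric _ h^-1 w); rewrite gtr0_norm.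
apply: (@squeeze_cvgr _ _ _ _ (cst 0) (fun n => h^-1 * w ^+ n)) => //; last exact: cvg_cst.
apply: nearW => n /=; apply/andP; split; first by rewrite mulr_ge0// exprn_ge0.
by rewrite zw exprMn mulrA ler_wpM2r// exprn_ge0// ltW.
Unshelve. all: by end_near. Qed.

(** Approximates the indicator of y < 1/2 on [0, 1]. The classical exponent
    2 ^ n gives the limit 1 / e at y = 1/2; the extra factor n makes it 0 there,
    so the limit is a genuine indicator. *)
Definition step_poly (R : realType) n (y : R) := (1 - y ^+ n) ^+ (n * 2 ^ n).

Lemma step_poly_itv (R : realType) n (y : R) :
  0 <= y <= 1 -> 0 <= step_poly n y <= 1.
Proof.
move=> /andP[y0 y1]; have := exprn_ge0 n y0; have := exprn_ile1 n y0 y1.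
move=> h1 h2; apply/andP; split; first by apply: exprn_ge0; lra.
by apply: exprn_ile1; lra.
Qed.

(** Below 1/2 the Bernoulli inequality bounds the polynomial from below by
    1 - n (2y) ^ n. From 1/2 on, it gives (1 + y ^ n) ^ (n 2 ^ n) >= n + 1, and
    the product of this power with the polynomial is at most 1. *)
Lemma cvg_step_poly (R : realType) (y : R) : 0 <= y <= 1 ->
  step_poly n y @[n --> \oo] --> ((y < 2^-1)%R%:R : R).
Proof.
move=> y01; have /andP[y0 y1] := y01.
have yn n : 0 <= y ^+ n <= 1 by rewrite exprn_ge0// exprn_ile1.
have [y2|y2] := ltP y 2^-1.
  have z1 : 0 <= 2 * y < 1 by lra.
  apply: (@squeeze_cvgr _ _ _ _ (fun n => 1 - n%:R * (2 * y) ^+ n) (cst 1)).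
  - apply: nearW => n /=; have /andP[_ ->] := step_poly_itv n y01.
    rewrite andbT; have /andP[h1 h2] := yn n.
    have h3 : -1 <= - y ^+ n by lra.
    apply: le_trans (bernoulli_inequality (n * 2 ^ n) h3).
    by rewrite mulrN natrM natrX exprMn mulrA.
  - rewrite -[X in _ --> X]subr0; apply: cvgB; first exact: cvg_cst.
    exact: cvg_natM_expr.
  - exact: cvg_cst.
apply: (@squeeze_cvgr _ _ _ _ (cst 0) (fun n => n.+1%:R^-1)).
- apply: nearW => n /=; have /andP[s0 s1] := step_poly_itv n y01.
  rewrite s0/= -[leRHS]mul1r ler_pdivlMr//.
  have /andP[h1 h2] := yn n.
  have hm : n.+1%:R <= (1 + y ^+ n) ^+ (n * 2 ^ n).
    have h3 : -1 <= y ^+ n by lra.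
    apply: le_trans (bernoulli_inequality (n * 2 ^ n) h3).
    rewrite -natr1 addrC lerD2l natrM natrX -mulrA -exprMn ler_peMr//.
    by apply: exprn_ege1; lra.
  apply: le_trans (ler_wpM2l s0 hm) _.
  rewrite /step_poly -exprMn; apply: exprn_ile1; nra.
- exact: cvg_cst.
- exact: cvg_harmonic.
Qed.

Lemma cvg_bigprod (R : realType) (I : Type) (s : seq I) (F : nat -> I -> R) (l : I -> R) :
  (forall i, F ^~ i @ \oo --> l i) ->
  \prod_(i <- s) F n i @[n --> \oo] --> \prod_(i <- s) l i.
Proof.
move=> cF; elim: s => [|i s IH].
  by under eq_fun do rewrite big_nil; rewrite big_nil; exact: cvg_cst.
under eq_fun do rewrite big_cons; rewrite big_cons.
exact: cvgM.
Qed.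

Lemma prod_itv01 (R : realDomainType) (I : Type) (s : seq I) (F : I -> R) :
  (forall i, 0 <= F i <= 1) -> 0 <= \prod_(i <- s) F i <= 1.
Proof.
move=> F01; elim: s => [|i s /andP[h1 h2]]; first by rewrite big_nil ler01 lexx.
by have /andP[h3 h4] := F01 i; rewrite big_cons mulr_ge0//= mulr_ile1.
Qed.

(** Stretching the sine until z lies within half a period of 0 turns its sign
    into the sign of z: periodicity disappears in the limit. *)
Lemma sin_scale_gt0 (R : realType) (z : R) :
  \forall N \near \oo, (0 < sin (z / N.+1%:R)) = (0 < z).
Proof.
have h : z / N.+1%:R @[N --> \oo] --> (0 : R).
  rewrite -[X in _ --> X](mulr0 z); apply: cvgM; first exact: cvg_cst.
  exact: cvg_harmonic.
near=> N.
have /ltr_normlP[h1 h2] : `|z / N.+1%:R| < pi.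
  by near: N; apply: cvgr0_norm_lt => //; exact: pi_gt0.
have [z0|z0|z0] := ltgtP 0 z.
- by rewrite sin_gt0_pi// divr_gt0.
- apply/negbTE; rewrite -leNgt -oppr_ge0 -sinN; apply/ltW/sin_gt0_pi => //.
  by rewrite h1 andbT -mulNr divr_gt0// oppr_gt0.
- by rewrite -z0 mul0r sin0 ltxx.
Unshelve. all: by end_near. Qed.

(** * Trigonometric integrals determine a probability *)

Section Uniqueness.
Context d (T : measurableType d) (R : realType) (V : lmodType R).
Variable phi : V -> T -> R.
Hypothesis mphi : forall v, measurable_fun [set: T] (phi v).
Hypothesis phiD : forall u v x, phi (u + v) x = phi u x + phi v x.
Hypothesis phiZ : forall a v x, phi (a *: v) x = a * phi v x.

(** The linear span of the functions cos (phi v + c). The phase c provides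
    sines, the choice v = 0 constants, and the span is an algebra. *)
Inductive trig_poly : (T -> R) -> Prop :=
| trig_poly_cos v c : trig_poly (fun x => cos (phi v x + c))
| trig_poly_lin a f g : trig_poly f -> trig_poly g ->
    trig_poly (fun x => a * f x + g x).

Lemma eq_trig_poly f g : f =1 g -> trig_poly f -> trig_poly g.
Proof. by move=> /funext ->. Qed.

Lemma measurable_cos_phase v c :
  measurable_fun [set: T] (fun x => cos (phi v x + c)).
Proof. by apply: measurable_cos_fun; exact: measurable_funD. Qed.

Lemma trig_poly_bounded f : trig_poly f ->
  measurable_fun [set: T] f /\ exists M, forall x, `|f x| <= M.
Proof.
elim=> [v c|a {}f g _ [mf [M fM]] _ [mg [K gK]]].
  split; first exact: measurable_cos_phase.
  by exists 1 => x; exact: cos_max.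
split; first by apply: measurable_funD => //; exact: measurable_funM.
exists (`|a| * M + K) => x; apply: le_trans (ler_normD _ _) _.
by rewrite normrM lerD// ler_wpM2l.
Qed.

Lemma trig_poly_integrable (P : probability T R) f : trig_poly f ->
  P.-integrable [set: T] (EFin \o f).
Proof. by move=> /trig_poly_bounded[mf [M fM]]; exact: bounded_integrable fM. Qed.

Lemma phase0 x : phi 0 x = 0.
Proof. by rewrite -(scale0r 0) phiZ mul0r. Qed.

Lemma trig_poly_cst a : trig_poly (fun=> a).
Proof.
have t1 := trig_poly_cos 0 0.
apply: (eq_trig_poly _ (trig_poly_lin (a - 1) t1 t1)) => x.
by rewrite phase0 addr0 cos0; ring.
Qed.

Lemma trig_polyZ a f : trig_poly f -> trig_poly (fun x => a * f x).
Proof.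
move=> tf; apply: (eq_trig_poly _ (trig_poly_lin a tf (trig_poly_cst 0))) => x.
by rewrite addr0.
Qed.

(** Product-to-sum formula: the space of phases is closed under sum and
    difference. *)
Lemma trig_polyM f g : trig_poly f -> trig_poly g ->
  trig_poly (fun x => f x * g x).
Proof.
move=> tf; elim: tf g => [v c|a {}f h _ IHf _ IHh] g tg; last first.
  apply: (eq_trig_poly _ (trig_poly_lin a (IHf _ tg) (IHh _ tg))) => x.
  by ring.
elim: tg => [w e|a {}f h _ IHf _ IHh]; last first.
  by apply: (eq_trig_poly _ (trig_poly_lin a IHf IHh)) => x; ring.
have tD := trig_poly_cos (v + w) (c + e).
have tB := trig_poly_cos (v + (-1) *: w) (c - e).
apply: (eq_trig_poly _ (trig_poly_lin 2^-1 tD (trig_polyZ 2^-1 tB))) => x.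
rewrite !phiD phiZ.
have -> : phi v x + phi w x + (c + e) = (phi v x + c) + (phi w x + e) by ring.
have -> : phi v x + -1 * phi w x + (c - e) = (phi v x + c) - (phi w x + e).
  by ring.
by rewrite cosD cosB; field.
Qed.

Lemma trig_polyX n f : trig_poly f -> trig_poly (fun x => f x ^+ n).
Proof.
move=> tf; elim: n => [|n IH].
  by apply: (eq_trig_poly _ (trig_poly_cst 1)) => x; rewrite expr0.
by apply: (eq_trig_poly _ (trig_polyM tf IH)) => x; rewrite exprS.
Qed.

Lemma trig_poly_prod (I : Type) (s : seq I) (F : I -> T -> R) :
  (forall i, trig_poly (F i)) -> trig_poly (fun x => \prod_(i <- s) F i x).
Proof.
move=> tF; elim: s => [|i s IH].
  by apply: (eq_trig_poly _ (trig_poly_cst 1)) => x; rewrite big_nil.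
by apply: (eq_trig_poly _ (trig_polyM (tF i) IH)) => x; rewrite big_cons.
Qed.

Variables P Q : probability T R.
Hypothesis eq_cos : forall v c,
  \int[P]_x cos (phi v x + c) = \int[Q]_x cos (phi v x + c).

Lemma eq_trig_poly_integral f : trig_poly f -> \int[P]_x f x = \int[Q]_x f x.
Proof.
elim=> [v c|a {}f g tf IHf tg IHg]; first exact: eq_cos.
have h (M : probability T R) :
    \int[M]_x (a * f x + g x) = a * \int[M]_x f x + \int[M]_x g x.
  rewrite RintegralD//; last exact: trig_poly_integrable.
    by rewrite RintegralZl//; exact: trig_poly_integrable.
  exact/trig_poly_integrable/trig_polyZ.
by rewrite !h IHf IHg.
Qed.

Lemma eq_integral_lim (f_ : nat -> T -> R) f :
  (forall n, measurable_fun [set: T] (f_ n)) ->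
  (forall n x, 0 <= f_ n x <= 1) ->
  (forall x, f_ ^~ x @ \oo --> f x) ->
  (forall n, \int[P]_x f_ n x = \int[Q]_x f_ n x) ->
  \int[P]_x f x = \int[Q]_x f x.
Proof.
move=> mf f01 ff e.
have fb n x : `|f_ n x| <= cst 1 x.
  by have /andP[h1 h2] := f01 n x; rewrite /= ger0_norm.
have int1 (M : probability T R) : M.-integrable [set: T] (EFin \o cst 1).
  by apply: (@bounded_integrable _ _ _ _ _ 1) => // x; rewrite normr1.
have cP := dominated_cvg_Rintegral mf (int1 P) fb ff.
have cQ := dominated_cvg_Rintegral mf (int1 Q) fb ff.
rewrite -(cvg_lim _ cP)// -(cvg_lim _ cQ)//.
by congr (lim (_ @ \oo)); exact/funext.
Qed.

(** Finite intersections of half-spaces, indexed by lists so that intersection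
    is concatenation and the whole space is the empty list: a pi-system. *)
Definition halfspaces (s : seq (V * R)) : set T :=
  [set x | all (fun p => p.2 < phi p.1 x) s].

(** The indicator of an intersection of half-spaces is an iterated bounded limit
    of trigonometric polynomials: [step_poly] of (1 - sin ((phi - a) / N)) / 2
    tends with n to the indicator of sin ((phi - a) / N) > 0, which tends with N
    to the indicator of phi > a. *)
Lemma eq_halfspaces s : P (halfspaces s) = Q (halfspaces s).
Proof.
pose y N (p : V * R) x := (1 - sin ((phi p.1 x - p.2) / N.+1%:R)) / 2.
have y01 N p x : 0 <= y N p x <= 1.
  have := sin_le1 ((phi p.1 x - p.2) / N.+1%:R).
  have := sin_geN1 ((phi p.1 x - p.2) / N.+1%:R).
  by rewrite /y => h1 h2; lra.
pose F N n x := \prod_(p <- s) step_poly n (y N p x).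
pose G N x := \prod_(p <- s) (((y N p x < 2^-1)%R%:R) : R).
pose H x := \prod_(p <- s) (((p.2 < phi p.1 x)%R%:R) : R).
have tF N n : trig_poly (F N n).
  apply: trig_poly_prod => p; apply: trig_polyX.
  have ty : trig_poly (y N p).
    (* A sine is a cosine shifted by pi / 2. *)
    have tc := trig_poly_cos (N.+1%:R^-1 *: p.1) (- p.2 / N.+1%:R - pi / 2).
    apply: (eq_trig_poly _ (trig_poly_lin (- 2^-1) tc (trig_poly_cst 2^-1))) => x.
    rewrite addrA cosBpihalf /y phiZ.
    have -> : N.+1%:R^-1 * phi p.1 x + - p.2 / N.+1%:R =
      (phi p.1 x - p.2) / N.+1%:R by ring.
    by field.
  apply: (eq_trig_poly _ (trig_poly_lin (-1) (trig_polyX n ty) (trig_poly_cst 1))) => x.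
  by ring.
have mF N n : measurable_fun [set: T] (F N n).
  by have [] := trig_poly_bounded (tF N n).
have F01 N n x : 0 <= F N n x <= 1.
  by apply: prod_itv01 => p; exact: step_poly_itv.
have FG N x : F N ^~ x @ \oo --> G N x.
  by apply: cvg_bigprod => p; exact: cvg_step_poly.
have GPQ N : \int[P]_x G N x = \int[Q]_x G N x.
  apply: (eq_integral_lim (mF N) (F01 N) (FG N)) => n.
  exact: eq_trig_poly_integral.
have mG N : measurable_fun [set: T] (G N).
  by apply: (measurable_fun_cvg (mF N)) => x _; exact: FG.
have G01 N x : 0 <= G N x <= 1 by apply: prod_itv01 => p; case: ltP => _; rewrite /= ?lexx ?ler01.
have GH x : G ^~ x @ \oo --> H x.
  apply: cvg_bigprod => p; apply: cvg_near_cst.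
  have := sin_scale_gt0 (phi p.1 x - p.2); apply: filterS => N.
  rewrite subr_gt0 => <-; congr (nat_of_bool _)%:R.
  by rewrite /y; apply/idP/idP => ?; lra.
have HE : H = \1_(halfspaces s).
  apply/funext => x; rewrite /H indicE.
  have -> : (x \in halfspaces s) = all (fun p => p.2 < phi p.1 x) s.
    by apply/idP/idP => [h|h]; [exact: (set_mem h)|exact: mem_set].
  elim: (s) => [|p t IH]; first by rewrite big_nil.
  by rewrite big_cons IH /=; case: (p.2 < _); rewrite ?mul1r ?mul0r.
have mH : measurable (halfspaces s).
  rewrite (_ : halfspaces s = H @^-1` [set 1]); last first.
    apply/seteqP; split => x /=; rewrite HE indicE; first by move=> h; rewrite mem_set.
    by case: (boolP (x \in halfspaces s)) => [/set_mem//|_ /eqP]; rewrite eq_sym oner_eq0.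
  have mfH : measurable_fun [set: T] H.
    by apply: (measurable_fun_cvg mG) => x _; exact: GH.
  by rewrite -[_ @^-1` _]setTI; exact: mfH.
have e := eq_integral_lim mG G01 GH GPQ.
have PE (M : probability T R) : M (halfspaces s) = (\int[M]_x H x)%:E.
  rewrite HE /Rintegral integral_indic// setIT fineK//.
  exact: fin_num_measure.
by rewrite !PE e.
Qed.

(** A Cramer-Wold theorem: the half-spaces generate the sigma-algebra and their
    finite intersections form a pi-system on which the probabilities agree. *)
Lemma eq_probability_of_cos :
  measurable = <<s [set A | exists v a, A = [set x | a < phi v x]] >> ->
  forall A, measurable A -> P A = Q A.
Proof.
move=> gen A mA.
pose G := range halfspaces.
have mh v a : measurable [set x | a < phi v x].
  by rewrite gen; apply: sub_sigma_algebra; exists v, a.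
have mG : measurable = <<s G >>.
  apply/seteqP; split.
    rewrite gen; apply: smallest_sub; first exact: smallest_sigma_algebra.
    move=> _ [v [a ->]]; apply: sub_sigma_algebra; exists [:: (v, a)] => //.
    by apply/seteqP; split => x; rewrite /halfspaces/= andbT.
  apply: smallest_sub; first exact: sigma_algebra_measurable.
  move=> _ [s _ <-]; elim: s => [|p s IH].
    by rewrite (_ : halfspaces [::] = setT)//; apply/seteqP.
  rewrite (_ : halfspaces _ = [set x | p.2 < phi p.1 x] `&` halfspaces s).
    exact: measurableI.
  by apply/seteqP; split => x /=; [move=> /andP[]|move=> [h1 h2]; apply/andP].
apply: (measure_unique G (fun=> setT) mG) => //.
- move=> _ _ [s _ <-] [t _ <-]; exists (s ++ t) => //.
  apply/seteqP; split => x; rewrite /halfspaces/= all_cat.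
    by move/andP.
  by move=> [h1 h2]; apply/andP.
- by move=> _; exists [::] => //; apply/seteqP.
- by rewrite bigcup_const.
- by move=> _ [s _ <-]; exact: eq_halfspaces.
- by move=> _; rewrite [ltLHS]probability_setT ltry.
Qed.

End Uniqueness.

Lemma eq_real_probability (R : realType) (P Q : probability (measurableTypeR R) R) :
  (forall t c, \int[P]_x cos (t * x + c) = \int[Q]_x cos (t * x + c)) ->
  forall A, measurable A -> P A = Q A.
Proof.
move=> e.
apply: (@eq_probability_of_cos _ (measurableTypeR R) R R^o
  (fun t x => t * x : R)) => //.
- by move=> t; apply: measurable_funM => //; exact: measurable_id.
- by move=> u v x; rewrite mulrDl.
- by move=> a v x; rewrite -mulrA.
apply/seteqP; split.
  rewrite [X in X `<=` _](RGenOInfty.measurableE R).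
  apply: smallest_sub; first exact: smallest_sigma_algebra.
  move=> _ [a ->]; apply: sub_sigma_algebra; exists 1, a.
  by apply/seteqP; split => x /=; rewrite in_itv/= andbT mul1r.
apply: smallest_sub; first exact: sigma_algebra_measurable.
move=> _ [v [a ->]].
have mv : measurable_fun [set: measurableTypeR R] (fun x : measurableTypeR R => v * x : R).
  by apply: measurable_funM => //; exact: measurable_id.
have := mv measurableT `]a, +oo[%classic (measurable_itv _).
rewrite setTI; congr (measurable _).
by apply/seteqP; split => x /=; rewrite in_itv/= andbT.
Qed.

Section LinearForms.
Context (R : realType) (d : nat).
Implicit Types (u : 'cV[R]_d) (x : vecspace R d).

Lemma linear_formE u x : (u^T *m colv x) 0 0 = \sum_i u i 0 * tnth x i.
Proof. by rewrite mxE; apply: eq_bigr => i _; rewrite !mxE. Qed.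

Lemma measurable_coord (i : 'I_d) :
  measurable_fun [set: vecspace R d] (fun x => tnth x i : R).
Proof. exact: (@measurable_tnth _ (measurableTypeR R)). Qed.

Lemma measurable_linear_form u :
  measurable_fun [set: vecspace R d] (fun x => (u^T *m colv x) 0 0).
Proof.
under eq_fun do rewrite linear_formE.
apply: measurable_sum => i; apply: measurable_funM => //.
exact: measurable_coord.
Qed.

(** The half-spaces of the coordinate forms already generate the product
    sigma-algebra. *)
Lemma eq_vecspace_probability (P Q : probability (vecspace R d) R) :
  (forall u c, \int[P]_x cos ((u^T *m colv x) 0 0 + c) =
               \int[Q]_x cos ((u^T *m colv x) 0 0 + c)) ->
  forall A, measurable A -> P A = Q A.
Proof.
move=> e; pose phi u x := (u^T *m colv x) 0 0.
apply: (@eq_probability_of_cos _ _ R _ phi) => //.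
- exact: measurable_linear_form.
- by move=> u v x; rewrite /phi linearD mulmxDl mxE.
- by move=> a v x; rewrite /phi linearZ/= -scalemxAl mxE.
apply/seteqP; split.
  rewrite {1}/measurable/=; apply: smallest_sub; first exact: smallest_sigma_algebra.
  move=> B; rewrite -bigcup_seq/= => -[i _ [A mA <-]].
  have phii x : phi (delta_mx i 0) x = tnth x i.
    rewrite /phi linear_formE (bigD1 i)//= big1 ?addr0 ?mxE ?eqxx ?mul1r//.
    by move=> j ji; rewrite !mxE (negbTE ji) mul0r.
  pose S := <<s [set A | exists v a, A = [set x | a < phi v x]] >>.
  suff: @measurable _ (measurableTypeR R) `<=`
      image_set_system setT (@tnth d (measurableTypeR R) ^~ i) S by apply.
  rewrite [X in X `<=` _](RGenOInfty.measurableE R).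
  apply: smallest_sub.
    exact/sigma_algebra_image/smallest_sigma_algebra.
  move=> _ [a ->]; rewrite /image_set_system/= setTI.
  apply: sub_sigma_algebra; exists (delta_mx i 0), a.
  by apply/seteqP; split => x /=; rewrite in_itv/= andbT phii.
apply: smallest_sub; first exact: sigma_algebra_measurable.
move=> _ [v [a ->]].
have := measurable_linear_form v measurableT (measurable_itv `]a, +oo[).
rewrite setTI; congr (measurable _).
by apply/seteqP; split => x /=; rewrite in_itv/= andbT.
Qed.

End LinearForms.

(** * The trigonometric transform of a normal law *)

(** The fundamental theorem of calculus on [-n, n], with n tending to infinity.
    For f the derivative of a product F this is integration by parts on the line. *)
Lemma integral_derivative_eq0 (R : realType) (F f : R -> R) :
  (forall x, is_derive x (1 : R) F (f x)) -> continuous f ->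
  (@lebesgue_measure R).-integrable [set: R] (EFin \o f) ->
  F n%:R @[n --> \oo] --> 0 -> F (- n%:R) @[n --> \oo] --> 0 ->
  \int[@lebesgue_measure R]_x f x = 0.
Proof.
move=> dF cf intf Fp Fn.
pose I n : set R := `[- n%:R, n%:R]%classic.
pose g n := f \_ (I n).
have mf : measurable_fun [set: R] f by exact: continuous_measurable_fun.
have mg n : measurable_fun [set: R] (g n).
  have mI : measurable (I n) by exact: measurable_itv.
  have [h _] := measurable_restrictT f mI; apply: h.
  exact: measurable_funTS.
have intn : (@lebesgue_measure R).-integrable [set: R] (EFin \o (fun x => `|f x|)).
  exact: integrable_norm intf.
have gle k x : `|g k x| <= `|f x|.
  by rewrite /g /patch; case: ifP => // _; rewrite normr0.
have gf x : g ^~ x @ \oo --> f x.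
  apply: cvg_near_cst; near=> k; rewrite /g patchE mem_set// /I/= in_itv/=.
  have : `|x| <= k%:R by near: k; exact: nbhs_infty_ger.
  by rewrite ler_norml.
have cI := @dominated_cvg_Rintegral _ (measurableTypeR R) R _ _ _ _ mg intn gle gf.
rewrite -(cvg_lim _ cI)//; apply: cvg_lim => //.
have cF : F n%:R - F (- n%:R) @[n --> \oo] --> 0.
  by rewrite -[X in _ --> X](subr0 0); exact: cvgB.
apply: cvg_trans cF; apply: near_eq_cvg; near=> n.
rewrite -Rintegral_mkcond /Rintegral.
have n0 : (0 < n)%N by near: n; exact: nbhs_infty_gt.
have nn : - n%:R < n%:R :> R by rewrite gtrN ?ltr0n.
have cFc : continuous F.
  by move=> x; apply/differentiable_continuous/derivable1_diffP; have [] := dF x.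
rewrite (@continuous_FTC2 _ f F)//.
- exact: continuous_subspaceT.
- split.
  + by move=> x _; have [] := dF x.
  + by apply: cvg_at_right_filter; exact: cFc.
  + by apply: cvg_at_left_filter; exact: cFc.
- by move=> x _; rewrite derive1E; have [] := dF x.
Unshelve. all: by end_near. Qed.

Section NormalCos.
Context (R : realType) (m s : R).
Hypothesis s0 : s != 0.
Local Notation p := (normal_pdf m s).
Local Notation leb := (@lebesgue_measure R).

Let s20 : 0 < s ^+ 2. Proof. by rewrite exprn_even_gt0. Qed.

Lemma is_derive_normal_pdf x : is_derive x (1 : R) p (- ((x - m) / s ^+ 2) * p x).
Proof.
rewrite (normal_pdfE m s0).
pose h (x : R) := - (x - m) ^+ 2 / (s ^+ 2 *+ 2).
have dh : is_derive x (1 : R) h (- (x - m) / s ^+ 2).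
  rewrite /h; apply: is_derive_eq.
  by rewrite /GRing.scale/=; field.
have de := @is_derive1_comp _ expR h x _ _ (is_derive_expR _) dh.
have dz := is_deriveZ (normal_peak s) de.
apply: (@is_derive_eq _ _ _ _ _ _ _ _ dz).
by rewrite /normal_fun -/(h x) /GRing.scale/=; ring.
Qed.

(** The linear factor is absorbed by half of the exponent: with
    w = (x - m)^2 / (4 s^2) one has w exp (- w) <= 1, so the function is
    dominated by a combination of the densities of deviations s and sqrt 2 s. *)
Lemma integrable_norm_normal_pdf :
  leb.-integrable [set: R] (EFin \o (fun x => `|x - m| * p x)).
Proof.
pose s' := Num.sqrt 2 * s.
have s'0 : s' != 0 by rewrite mulf_neq0// sqrtr_eq0 -ltNge.
have s'2 : s' ^+ 2 = 2 * s ^+ 2 by rewrite exprMn sqr_sqrtr.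
(* The ratio of the normalizing constants of the two densities, times the bound
   4 s^2 w for (x - m)^2. *)
pose K := normal_peak s * (4 * s ^+ 2) / normal_peak s'.
have mn : measurable_fun [set: measurableTypeR R] (fun x : measurableTypeR R => `|x - m| * p x).
  apply: measurable_funM; last exact: measurable_normal_pdf.
  apply: measurableT_comp => //; apply: measurable_funB => //; exact: measurable_id.
have ig : leb.-integrable [set: R]
    (EFin \o (fun x => p x + K * normal_pdf m s' x)).
  have i1 := integrable_normal_pdf m s.
  have i2 := integrableZl measurableT K (integrable_normal_pdf m s').
  exact: integrableD i1 i2.
apply: le_integrable ig => //; first exact/measurable_EFinP.
move=> x _; rewrite lee_fin.
have K0 : 0 <= K.
  apply: divr_ge0; last exact: normal_peak_ge0.
  apply: mulr_ge0; first exact: normal_peak_ge0.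
  by apply: mulr_ge0 => //; exact: ltW.
rewrite [leRHS]ger0_norm; last first.
  by rewrite addr_ge0 ?(mulr_ge0 K0)// normal_pdf_ge0.
rewrite ger0_norm; last by apply: mulr_ge0 => //; exact: normal_pdf_ge0.
have -> : K * normal_pdf m s' x = normal_peak s * (4 * s ^+ 2) * normal_fun m s' x.
  rewrite normal_pdfE// /K; field.
  by rewrite gt_eqF// normal_peak_gt0.
rewrite normal_pdfE// /normal_fun s'2.
pose w := (x - m) ^+ 2 / (4 * s ^+ 2).
have w0 : 0 <= w by apply: divr_ge0; [exact: sqr_ge0|apply: mulr_ge0 => //; exact: ltW].
have -> : - (x - m) ^+ 2 / (s ^+ 2 *+ 2) = - w - w by rewrite /w; field.
have -> : - (x - m) ^+ 2 / (2 * s ^+ 2 *+ 2) = - w by rewrite /w; field.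
have nx : `|x - m| <= 1 + 4 * s ^+ 2 * w.
  have -> : 4 * s ^+ 2 * w = `|x - m| ^+ 2.
    by rewrite -normrX ger0_norm ?sqr_ge0// /w; field.
  by have := sqr_ge0 (`|x - m| - 1); have := normr_ge0 (x - m); nra.
have e1 : w * expR (- w) <= 1.
  rewrite expRN -ler_pdivlMr ?invr_gt0 ?expR_gt0// invrK mul1r.
  by apply: le_trans (expR_ge1Dx w); rewrite lerDr.
have pk := normal_peak_ge0 s; rewrite expRD; have := expR_gt0 (- w).
move: (expR (- w)) e1 => e e1 e0.
rewrite mulrCA -[normal_peak s * _ * e]mulrA -mulrDr; apply: ler_wpM2l => //.
apply: le_trans (ler_wpM2r _ nx) _; first by rewrite mulr_ge0// ltW.
rewrite mulrDl mul1r lerD2l -[_ * w * _]mulrA; apply: ler_wpM2l.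
  by apply: mulr_ge0 => //; exact: ltW.
by rewrite mulrA ler_piMl// ltW.
Qed.

(** The density is even around its mean, so one limit gives both. *)
Lemma cvg_normal_pdf_infty (u : nat -> R) : u n @[n --> \oo] --> +oo%R ->
  p (m + u n) @[n --> \oo] --> 0 /\ p (m - u n) @[n --> \oo] --> 0.
Proof.
move=> cu.
pose k := (Num.sqrt (s ^+ 2 *+ 2))^-1.
have k0 : 0 < k by rewrite invr_gt0 sqrtr_gt0 pmulrn_lgt0.
have pE z : p (m + z) = normal_peak s * gauss_fun (z * k).
  rewrite normal_pdfE// /normal_fun /gauss_fun; congr (_ * expR _).
  by rewrite [m + z]addrC addrK exprMn exprVn sqr_sqrtr ?mulrn_wge0 ?ltW// mulNr.
have pN z : p (m - z) = p (m + z).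
  by rewrite !pE /gauss_fun mulNr sqrrN.
suff h : p (m + u n) @[n --> \oo] --> 0.
  by split => //; under eq_fun do rewrite pN.
under eq_fun do rewrite pE.
suff h : normal_peak s * gauss_fun (u n * k) @[n --> \oo] --> normal_peak s * 0.
  by rewrite mulr0 in h.
apply: cvgM; first exact: cvg_cst.
apply: (cvg_comp u (fun z => gauss_fun (z * k)) cu).
apply: (cvg_comp (fun z => z * k) gauss_fun); last exact: cvg_gauss_fun.
by apply: (gt0_cvgMly k0); exact: cvg_id.
Qed.

Lemma integrable_bounded_normal_pdf (f : R -> R) : continuous f ->
  (forall x, `|f x| <= 1) ->
  leb.-integrable [set: R] (EFin \o (fun x => f x * p x)).
Proof.
move=> cf f1; apply: le_integrable (integrable_normal_pdf m s) => //.
  apply/measurable_EFinP; apply: measurable_funM; last exact: measurable_normal_pdf.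
  exact: continuous_measurable_fun.
move=> x _; rewrite lee_fin normrM ler_piMl//.
Qed.

Lemma integrable_bounded_norm_normal_pdf (f : R -> R) : continuous f ->
  (forall x, `|f x| <= 1) ->
  leb.-integrable [set: R] (EFin \o (fun x => f x * ((x - m) * p x))).
Proof.
move=> cf f1; apply: le_integrable integrable_norm_normal_pdf => //.
  apply/measurable_EFinP; apply: measurable_funM; first exact: continuous_measurable_fun.
  apply: measurable_funM; last exact: measurable_normal_pdf.
  apply: measurable_funB => //; exact: measurable_id.
by move=> x _; rewrite lee_fin !normrM normr_id ler_piMl// mulr_ge0.
Qed.

Let ph (t c x : R) : R := t * (x - m) + c.

Let is_derive_ph (t c : R) x : is_derive x (1 : R) (ph t c) t.
Proof. by rewrite /ph; apply: is_derive_eq; rewrite /GRing.scale/=; ring. Qed.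

Let continuous_ph (t c : R) : continuous (ph t c).
Proof.
move=> x; apply/differentiable_continuous/derivable1_diffP.
by have [] := is_derive_ph t c x.
Qed.

Let continuous_cos_ph (t c : R) : continuous (fun x => cos (ph t c x)).
Proof. by move=> x; apply: continuous_comp; [exact: continuous_ph|exact: continuous_cos]. Qed.

Let continuous_sin_ph (t c : R) : continuous (fun x => sin (ph t c x)).
Proof. by move=> x; apply: continuous_comp; [exact: continuous_ph|exact: continuous_sin]. Qed.

(** Integrates the derivative of sin (t (x - m) + c) p x, using that
    p' = - (x - m) / s^2 p. *)
Lemma normal_sin_by_parts (t c : R) :
  \int[leb]_x (sin (t * (x - m) + c) * ((x - m) * p x)) =
  s ^+ 2 * t * \int[leb]_x (cos (t * (x - m) + c) * p x).
Proof.
pose F x := sin (ph t c x) * p x.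
pose f x := t * (cos (ph t c x) * p x) - s ^- 2 * (sin (ph t c x) * ((x - m) * p x)).
have dF x : is_derive x (1 : R) F (f x).
  have ds := @is_derive1_comp _ sin (ph t c) x _ _ (is_derive_sin _) (is_derive_ph t c x).
  have dm := is_deriveM ds (is_derive_normal_pdf x).
  apply: (@is_derive_eq _ _ _ _ _ _ _ _ dm).
  by rewrite /f /GRing.scale/=; field.
have i1 := integrable_bounded_normal_pdf (@continuous_cos_ph t c) (fun x => cos_max _).
have i2 := integrable_bounded_norm_normal_pdf (@continuous_sin_ph t c) (fun x => sin_max _).
have i1' : leb.-integrable [set: R] (EFin \o (fun x => t * (cos (ph t c x) * p x))).
  exact: integrableZl i1.
have i2' : leb.-integrable [set: R] (EFin \o (fun x => s ^- 2 * (sin (ph t c x) * ((x - m) * p x)))).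
  exact: integrableZl i2.
have intf : leb.-integrable [set: R] (EFin \o f).
  exact: integrableB i1' i2'.
have cf : continuous f.
  move=> x; apply: cvgB; (apply: cvgM; first exact: cvg_cst).
    by apply: cvgM; [exact: continuous_cos_ph|exact: continuous_normal_pdf].
  apply: cvgM; first exact: continuous_sin_ph.
  apply: cvgM; last exact: continuous_normal_pdf.
  by apply: cvgB; [exact: cvg_id|exact: cvg_cst].
have F0 (y : nat -> R) : p (y n) @[n --> \oo] --> 0 -> F (y n) @[n --> \oo] --> 0.
  move=> cp; apply/norm_cvg0P; apply: (@squeeze_cvgr _ _ _ _ (cst 0) _ _ _ _ _ cp).
    apply: nearW => n; rewrite normr_ge0/= normrM (ger0_norm (normal_pdf_ge0 _ _ _)).
    by rewrite ler_piMl ?normal_pdf_ge0 ?sin_max.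
  exact: cvg_cst.
have cadd (a : R) : n%:R + a @[n --> \oo] --> +oo%R.
  exact: (cvg_comp _ _ cvgr_idn (cvg_addrr a)).
have e0 : \int[leb]_x f x = 0.
  apply: (integral_derivative_eq0 dF cf intf); apply: F0.
    have cu := cadd (- m).
    have [+ _] := cvg_normal_pdf_infty cu.
    by under eq_fun do rewrite subrKC.
  have cu := cadd m.
  have [_ +] := cvg_normal_pdf_infty cu.
  by under eq_fun do rewrite opprD addrCA subrr addr0.
move: e0; rewrite RintegralB// !RintegralZl// => /eqP; rewrite subr_eq0 => /eqP e.
by rewrite -mulrA e mulrA divff ?mul1r// expf_neq0.
Qed.

(** Differentiation under the integral sign brings down the factor x - m, which
    [normal_sin_by_parts] trades for s^2 t: the transform of the normal density
    solves the equation y' = - s^2 t y. *)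
Lemma is_derive_normal_cos (c t : R) :
  is_derive t (1 : R) (fun t => \int[leb]_x (cos (t * (x - m) + c) * p x))
    (- (s ^+ 2 * t * \int[leb]_x (cos (t * (x - m) + c) * p x))).
Proof.
pose f (t x : R) := cos (t * (x - m) + c) * p x.
have df (t' x : R) : is_derive t' (1 : R) (f ^~ x)
    (- (sin (t' * (x - m) + c) * ((x - m) * p x))).
  have dh : is_derive t' (1 : R) (fun t => t * (x - m) + c) (x - m).
    by apply: is_derive_eq; rewrite /GRing.scale/=; ring.
  have dc := @is_derive1_comp _ cos _ t' _ _ (is_derive_cos _) dh.
  have dz := is_deriveZ (p x) dc.
  rewrite (_ : f ^~ x = p x \*: (cos \o (fun t => t * (x - m) + c))); last first.
    by apply/funext => y; rewrite /f /GRing.scale/= mulrC.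
  apply: (@is_derive_eq _ _ _ _ _ _ _ _ dz).
  by rewrite /GRing.scale/=; ring.
have pE t' x : partial1of2 f t' x = - (sin (t' * (x - m) + c) * ((x - m) * p x)).
  by rewrite partial1of2E; have [] := df t' x.
have tI : `]t - 1, t + 1[%classic t by rewrite /= in_itv/=; lra.
have i1 t' : `]t - 1, t + 1[%classic t' -> leb.-integrable [set: R] (EFin \o f t').
  move=> _; apply: (integrable_bounded_normal_pdf (@continuous_cos_ph t' c)) => y.
  exact: cos_max.
have d1 t' x : `]t - 1, t + 1[%classic t' -> [set: R] x -> derivable (f ^~ x) t' 1.
  by move=> _ _; have [] := df t' x.
have i2 := integrable_norm_normal_pdf.
have G0 x : 0 <= `|x - m| * p x by rewrite mulr_ge0// normal_pdf_ge0.
have Gub t' x : `]t - 1, t + 1[%classic t' -> [set: R] x ->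
    `|partial1of2 f t' x| <= `|x - m| * p x.
  move=> _ _; rewrite pE normrN !normrM [`|p x|]ger0_norm ?normal_pdf_ge0//.
  by rewrite ler_piMl// sin_max.
apply: DeriveDef.
  exact: (derivable_under_integral measurableT tI i1 d1 G0 i2 Gub).
rewrite -derive1E (differentiation_under_integral measurableT tI i1 d1 G0 i2 Gub).
under eq_Rintegral do rewrite pE -mulN1r.
rewrite RintegralZl//; last first.
  apply: (integrable_bounded_norm_normal_pdf (@continuous_sin_ph t c)) => y.
  exact: sin_max.
by rewrite mulN1r normal_sin_by_parts.
Qed.

(** By [is_derive_normal_cos] the product of the integral with
    exp (s^2 t^2 / 2) is constant in t. *)
Lemma integral_cos_normal_pdf (t c : R) :
  \int[leb]_x (cos (t * (x - m) + c) * p x) = cos c * expR (- (s ^+ 2 * t ^+ 2 / 2)).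
Proof.
pose C t := \int[leb]_x (cos (t * (x - m) + c) * p x).
pose E (t : R) := expR (s ^+ 2 * t ^+ 2 / 2).
have dE (y : R) : is_derive y (1 : R) E (s ^+ 2 * y * E y).
  have dh : is_derive y (1 : R) (fun t : R => s ^+ 2 * t ^+ 2 / 2) (s ^+ 2 * y).
    by apply: is_derive_eq; rewrite /GRing.scale/=; field.
  have de := @is_derive1_comp _ expR _ y _ _ (is_derive_expR _) dh.
  by apply: (@is_derive_eq _ _ _ _ _ _ _ _ de); rewrite mulrC.
have dCE (y : R) : is_derive y (1 : R) (C * E) 0.
  have := is_deriveM (is_derive_normal_cos c y) (dE y).
  move=> dm; apply: (@is_derive_eq _ _ _ _ _ _ _ _ dm).
  by rewrite /GRing.scale/= /C; ring.
have := is_derive_0_is_cst t 0 dCE.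
rewrite !fctE /E expr0n/= mulr0 mul0r expR0 mulr1 => e.
rewrite expRN -[LHS](mulfK (lt0r_neq0 (expR_gt0 (s ^+ 2 * t ^+ 2 / 2)))) -/(C t) e.
congr (_ / _); rewrite /C; under eq_Rintegral do rewrite mul0r add0r.
rewrite RintegralZl//; last exact: integrable_normal_pdf.
by rewrite /Rintegral integral_normal_pdf mulr1.
Qed.

(** The density is a Radon-Nikodym derivative of the normal probability, by
    almost sure uniqueness of that derivative. *)
Lemma Rintegral_normal_prob (f : R -> R) : continuous f -> (forall x, `|f x| <= 1) ->
  \int[normal_prob m s]_x f x = \int[leb]_x (f x * p x).
Proof.
move=> cf f1; congr fine.
have mf : measurable_fun [set: measurableTypeR R] (f : measurableTypeR R -> R).
  exact: continuous_measurable_fun.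
have intf : (normal_prob m s).-integrable [set: measurableTypeR R] (EFin \o f).
  exact: (@bounded_integrable _ (measurableTypeR R) R (normal_prob m s) f 1).
rewrite -(Radon_Nikodym_change_of_variables (normal_prob_dominates m s))//=.
apply: ae_eq_integral => //.
- apply: emeasurable_funM; first exact/measurable_EFinP.
  apply: (measurable_int leb).
  by apply: Radon_Nikodym_integrable; exact: normal_prob_dominates.
- apply/measurable_EFinP; apply: measurable_funM => //; exact: measurable_normal_pdf.
- under [X in ae_eq _ _ _ X]eq_fun do rewrite EFinM.
  apply: ae_eqe_mul2l => /=.
  rewrite Radon_NikodymE//=; first exact: normal_prob_dominates.
  move=> dom.
  case: cid => /= h [h1 h2 h3].
  apply: integral_ae_eq => //=.
  + by apply/measurable_EFinP; exact: measurable_normal_pdf.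
  + by move=> E _ mE; rewrite -h3.
Qed.

End NormalCos.

Section NormalLaw.
Context (R : realType).

(** [normal_law] as a bundled probability, so that one can integrate against it. *)
Definition normal_law_prob (a v : R) : probability (measurableTypeR R) R :=
  if v == 0 then (dirac (a : measurableTypeR R) : probability (measurableTypeR R) R)
  else (normal_prob a (Num.sqrt v) : probability (measurableTypeR R) R).

Lemma normal_law_probE a v A : normal_law_prob a v A = normal_law a v A.
Proof. by rewrite /normal_law_prob /normal_law; case: ifP. Qed.

Lemma measurable_affine (t c : R) :
  measurable_fun [set: measurableTypeR R] (fun x : measurableTypeR R => t * x + c : R).
Proof.
by apply: measurable_funD => //; apply: measurable_funM => //; exact: measurable_id.
Qed.

(** One formula covers the Dirac and the absolutely continuous cases; this is
    what makes degenerate covariances harmless in the sequel. *)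
Lemma integral_cos_normal_law (a v t c : R) : 0 <= v ->
  \int[normal_law_prob a v]_x cos (t * x + c) =
  cos (t * a + c) * expR (- (v * t ^+ 2 / 2)).
Proof.
move=> v0; rewrite /normal_law_prob; case: eqVneq => [->|vn0].
  rewrite !mul0r oppr0 expR0 mulr1 /Rintegral integral_dirac//.
    by rewrite diracT mul1e.
  apply/measurable_EFinP; apply: measurable_cos_fun; exact: measurable_affine.
have s0 : Num.sqrt v != 0 by rewrite sqrtr_eq0 -ltNge lt_def vn0.
rewrite Rintegral_normal_prob//; last 2 first.
- move=> x; apply: (@continuous_comp _ _ _ (fun x : R => t * x + c) cos).
    apply: cvgD; last exact: cvg_cst.
    by apply: cvgM; [exact: cvg_cst|exact: cvg_id].
  exact: continuous_cos.
- by move=> x; exact: cos_max.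
under eq_Rintegral => x _.
  have -> : t * x + c = t * (x - a) + (t * a + c) by ring.
  over.
by rewrite integral_cos_normal_pdf// sqr_sqrtr.
Qed.

End NormalLaw.

(** * Quadratic forms *)

Section QuadraticForms.
Context (R : realType) (d : nat).
Implicit Types (A : 'M[R]_d) (u v : 'cV[R]_d).

Lemma linear_formZ t u v : ((t *: u)^T *m v) 0 0 = t * (u^T *m v) 0 0.
Proof. by rewrite linearZ/= -scalemxAl mxE. Qed.

Lemma quadZ A t u :
  ((t *: u)^T *m A *m (t *: u)) 0 0 = t ^+ 2 * (u^T *m A *m u) 0 0.
Proof. by rewrite -mulmxA linear_formZ -!scalemxAr mxE mulmxA mulrA expr2. Qed.

Lemma bilinear_delta A i j :
  ((delta_mx i 0 : 'cV[R]_d)^T *m A *m (delta_mx j 0 : 'cV[R]_d)) 0 0 = A i j.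
Proof. by rewrite trmx_delta -rowE -colE !mxE. Qed.

Lemma linear_form_delta v i : ((delta_mx i 0 : 'cV[R]_d)^T *m v) 0 0 = v i 0.
Proof. by rewrite trmx_delta -rowE mxE. Qed.

Lemma quad_rank1 (x v : 'cV[R]_d) :
  (v^T *m (x *m x^T) *m v) 0 0 = ((v^T *m x) 0 0) ^+ 2.
Proof.
have -> : v^T *m (x *m x^T) *m v = (v^T *m x) *m (v^T *m x)^T.
  by rewrite trmx_mul trmxK !mulmxA.
by rewrite mxE big_ord1 [X in _ * X]mxE expr2.
Qed.

Lemma quad_line A u v t : A^T = A ->
  ((v + t *: u)^T *m A *m (v + t *: u)) 0 0 =
  (v^T *m A *m v) 0 0 + 2 * t * (u^T *m A *m v) 0 0 + t ^+ 2 * (u^T *m A *m u) 0 0.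
Proof.
move=> symA.
have polar : (v^T *m A *m u) 0 0 = (u^T *m A *m v) 0 0.
  transitivity (((v^T *m A *m u)^T) 0 0); first by rewrite [in RHS]mxE.
  by rewrite !trmx_mul symA trmxK mulmxA.
have eD x w : ((x + t *: w)^T : 'rV[R]_d) = x^T + t *: w^T.
  by apply/matrixP => i j; rewrite !mxE.
rewrite eD !mulmxDl !mulmxDr -!scalemxAl -!scalemxAr.
move: polar; move: (v^T *m A *m u) (u^T *m A *m v) (u^T *m A *m u) (v^T *m A *m v).
by move=> a b c e polar; rewrite !mxE polar; ring.
Qed.

(** Polarization. *)
Lemma quad_mx_inj A B : A^T = A -> B^T = B ->
  (forall v, (v^T *m A *m v) 0 0 = (v^T *m B *m v) 0 0) -> A = B.
Proof.
move=> sA sB e; apply/matrixP => i j.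
have := e (delta_mx j 0 + 1 *: delta_mx i 0).
rewrite !quad_line// !e !bilinear_delta mulr1 => /addIr/addrI.
by apply: mulfI.
Qed.

End QuadraticForms.

(** * Gaussian vectors and their uniqueness *)

Section GaussianCos.
Context (R : realType) (d : nat).
Implicit Types (mu : probability (vecspace R d) R) (m : 'cV[R]_d) (S : 'M[R]_d).

Let mform (u : 'cV[R]_d) : measurable_fun [set: vecspace R d]
  (fun x => (u^T *m colv x) 0 0 : measurableTypeR R) := measurable_linear_form u.

(** Absorbing t in the linear form turns a statement about all vectors into one
    about the real random variable <u, x>, for each u. *)
Lemma cos_transformZ mu m S :
  (forall (u : 'cV[R]_d) c, \int[mu]_x cos ((u^T *m colv x) 0 0 + c) =
    cos ((u^T *m m) 0 0 + c) * expR (- ((u^T *m S *m u) 0 0 / 2))) ->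
  forall (u : 'cV[R]_d) t c, \int[mu]_x cos (t * (u^T *m colv x) 0 0 + c) =
    cos (t * (u^T *m m) 0 0 + c) * expR (- ((u^T *m S *m u) 0 0 * t ^+ 2 / 2)).
Proof.
move=> h u t c; have := h (t *: u) c.
rewrite linear_formZ quadZ [t ^+ 2 * _]mulrC => <-.
by apply: eq_Rintegral => x _; rewrite linear_formZ.
Qed.

Lemma gaussian_law mu m S : gaussian mu m S -> forall (u : 'cV[R]_d) A, measurable A ->
  image_prob (mform u) mu A
  = normal_law_prob ((u^T *m m) 0 0) ((u^T *m S *m u) 0 0) A.
Proof. by move=> g u A mA; rewrite normal_law_probE -g. Qed.

(** Real probabilities are determined by their trigonometric integrals
    ([eq_real_probability]), so prescribing the normal law of every linear form
    amounts to prescribing these integrals. *)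
Lemma gaussianP mu m S : psd S ->
  gaussian mu m S <-> forall (u : 'cV[R]_d) c,
    \int[mu]_x cos ((u^T *m colv x) 0 0 + c) =
    cos ((u^T *m m) 0 0 + c) * expR (- ((u^T *m S *m u) 0 0 / 2)).
Proof.
move=> [_ S0]; have cosE (u : 'cV[R]_d) t c :
    \int[image_prob (mform u) mu]_y cos (t * y + c) =
    \int[mu]_x cos (t * (u^T *m colv x) 0 0 + c).
  rewrite (@Rintegral_image_prob _ _ _ _ _ _ (mform u) mu
    (fun y => cos (t * y + c)))//.
    by apply: measurable_cos_fun; exact: measurable_affine.
  apply: integrable_cos; apply: measurable_funD => //.
  apply: measurable_funM => //; exact: measurable_linear_form.
split=> [g u c|h u A mA].
  have := cosE u 1 c; under [in RHS]eq_Rintegral do rewrite mul1r.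
  move=> <-; rewrite (eq_probability_Rintegral _ (gaussian_law g u)).
  by rewrite integral_cos_normal_law// mul1r expr1n mulr1.
rewrite -normal_law_probE -[LHS]/(image_prob (mform u) mu A).
apply: eq_real_probability mA => t c.
by rewrite cosE integral_cos_normal_law// (cos_transformZ h).
Qed.

(** By [gaussianP] both have the same trigonometric transform. *)
Lemma gaussian_unique mu nu m S : psd S -> gaussian mu m S -> gaussian nu m S ->
  forall A, measurable A -> mu A = nu A.
Proof.
move=> S0 /(gaussianP _ _ S0) gmu /(gaussianP _ _ S0) gnu.
by apply: eq_vecspace_probability => u c; rewrite gmu gnu.
Qed.

End GaussianCos.

(** * Existence of Gaussian vectors *)

Section PsdDecomposition.
Context (R : realType) (d : nat).
Implicit Types (A : 'M[R]_d) (u v : 'cV[R]_d).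

(** Along the line e_j + t e_i the quadratic form is affine in t when A_ii = 0,
    hence nonnegative only if its slope vanishes. *)
Lemma psd_kernel A i : psd A -> A i i = 0 -> forall j, A i j = 0.
Proof.
move=> [symA A0] Aii j.
have H t : 0 <= A j j + 2 * t * A i j.
  have := A0 (delta_mx j 0 + t *: delta_mx i 0).
  by rewrite quad_line// !bilinear_delta Aii mulr0 addr0.
apply/eqP; apply: contraT => nz.
(* The value of t at which the affine function equals -1. *)
have := H (- (A j j + 1) / (2 * A i j)).
suff -> : A j j + 2 * (- (A j j + 1) / (2 * A i j)) * A i j = -1 by rewrite ler0N1.
by field.
Qed.

(** Subtracting the rank one part of column i minimizes the quadratic form along
    the direction e_i: with q = e_i^T A v, the new value at v is the old one at
    v - (q / A_ii) e_i. *)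
Lemma psd_deflate A i : psd A -> 0 < A i i ->
  psd (A - (A i i)^-1 *: (col i A *m (col i A)^T)).
Proof.
move=> [symA A0] Aii; split.
  rewrite linearB/= linearZ/= trmx_mul trmxK symA; congr (_ - _ *: _).
move=> v.
pose q := ((delta_mx i 0 : 'cV[R]_d)^T *m A *m v) 0 0.
have e1 : (v^T *m (col i A *m (col i A)^T) *m v) 0 0 = q ^+ 2.
  rewrite quad_rank1; congr (_ ^+ 2).
  transitivity ((v^T *m col i A)^T 0 0); first by rewrite [RHS]mxE.
  by rewrite trmx_mul trmxK colE trmx_mul symA.
have := A0 (v + (- q / A i i) *: delta_mx i 0).
rewrite quad_line// bilinear_delta -/q mulmxBr mulmxBl -scalemxAr -scalemxAl.
have -> x y : (x - (A i i)^-1 *: y : 'M[R]_1) 0 0 = x 0 0 - (A i i)^-1 * y 0 0.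
  by rewrite !mxE.
rewrite e1; congr (0 <= _); field; exact: lt0r_neq0.
Qed.

(** Each deflation ([psd_deflate]) annihilates a diagonal entry and, by
    [psd_kernel], keeps the vanishing ones equal to 0. When the whole diagonal
    vanishes, so does the matrix. *)
Lemma psd_sum_rank1 A : psd A ->
  exists s : seq 'cV[R]_d, A = \sum_(b <- s) b *m b^T.
Proof.
have [n] := ubnP #|[pred i | A i i != 0]|; elim: n A => // n IH A lt psdA.
have [symA A0] := psdA.
have [/forallP/= diag0|] := boolP [forall i, A i i == 0].
  exists [::]; rewrite big_nil; apply/matrixP => i j; rewrite mxE.
  exact: psd_kernel psdA (eqP (diag0 i)) j.
rewrite negb_forall => /existsP[i nz].
have Aii : 0 < A i i.
  by rewrite lt_def nz/=; have := A0 (delta_mx i 0); rewrite bilinear_delta.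
set B := A - (A i i)^-1 *: (col i A *m (col i A)^T).
have Bjj j : B j j = A j j - (A i i)^-1 * A j i ^+ 2.
  by rewrite !mxE big_ord1 !mxE expr2.
have [|s Bs] := IH B _ (psd_deflate psdA Aii).
  rewrite -ltnS; apply: leq_trans lt; apply: proper_card; apply/properP; split.
    apply/fintype.subsetP => j; rewrite !inE; apply: contra => /eqP Ajj.
    have Aji := psd_kernel psdA Ajj i.
    by rewrite Bjj Ajj Aji expr0n mulr0 subr0.
  exists i; rewrite !inE ?nz// negbK Bjj; apply/eqP.
  by field.
(* The rank one part that was subtracted, written as b b^T. *)
exists (((Num.sqrt (A i i))^-1 *: col i A) :: s).
rewrite big_cons -Bs linearZ/= -scalemxAl -scalemxAr scalerA -invfM -expr2.
by rewrite sqr_sqrtr ?ltW// addrC subrK.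
Qed.

End PsdDecomposition.

Section ProductProbability.
Context d1 d2 (T1 : measurableType d1) (T2 : measurableType d2) (R : realType).
Variables (P : probability T1 R) (Q : probability T2 R).

Let prod := (P \x Q)%E.

HB.instance Definition _ := Measure.on prod.

Let prodT : prod [set: T1 * T2] = 1%E.
Proof.
rewrite -setXTT [LHS]product_measure1E//.
transitivity (1 * 1 : \bar R)%E; last exact: mule1.
by congr (_ * _)%E; exact: probability_setT.
Qed.

HB.instance Definition _ := Measure_isProbability.Build _ _ _ prod prodT.

Definition product_prob : probability (T1 * T2)%type R := prod.

End ProductProbability.

Section Existence.
Context (R : realType) (d : nat).

Definition vec_of (v : 'cV[R]_d) : vecspace R d := [tuple v i 0 | i < d].

Lemma vec_ofK v : colv (vec_of v) = v.
Proof. by apply/matrixP => i j; rewrite mxE tnth_mktuple ord1. Qed.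

Lemma measurable_vec_of d' (T : measurableType d') (f : T -> 'cV[R]_d) :
  (forall i, measurable_fun [set: T] (fun x => f x i 0)) ->
  measurable_fun [set: T] (fun x => vec_of (f x)).
Proof.
move=> mf; apply/measurable_fun_tnthP => i.
rewrite (_ : _ \o _ = fun x => f x i 0); first exact: mf.
by apply/funext => x /=; rewrite tnth_mktuple.
Qed.

(** Adding an independent standard normal multiple of [b] multiplies the
    trigonometric transform by exp (- <u, b>^2 / 2), that is, adds b b^T to the
    covariance. The induction starts from a Dirac mass. *)
Lemma gaussian_rank1_exists (m : 'cV[R]_d) (s : seq 'cV[R]_d) :
  exists mu : probability (vecspace R d) R, forall (u : 'cV[R]_d) c,
    \int[mu]_x cos ((u^T *m colv x) 0 0 + c) =
    cos ((u^T *m m) 0 0 + c) *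
      expR (- ((u^T *m (\sum_(b <- s) b *m b^T) *m u) 0 0 / 2)).
Proof.
elim: s => [|b s [mu IH]].
  exists (dirac (vec_of m)) => u c.
  rewrite big_nil mulmx0 mul0mx [X in - (X / 2)]mxE mul0r oppr0 expR0 mulr1.
  rewrite /Rintegral integral_dirac//; first by rewrite diracT mul1e vec_ofK.
  apply/measurable_EFinP; apply: measurable_cos_fun; apply: measurable_funD => //.
  exact: measurable_linear_form.
pose f (z : vecspace R d * measurableTypeR R) : vecspace R d :=
  vec_of (colv z.1 + z.2 *: b).
have mf : measurable_fun [set: vecspace R d * measurableTypeR R] f.
  apply: measurable_vec_of => i.
  under eq_fun do rewrite !mxE.
  apply: measurable_funD; last by apply: measurable_funM => //; exact: measurable_snd.
  apply: (measurableT_comp (measurable_coord i)); exact: measurable_fst.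
exists (image_prob mf (product_prob mu (normal_law_prob 0 1))) => u c.
pose g (z : vecspace R d * measurableTypeR R) : R :=
  cos ((u^T *m b) 0 0 * z.2 + ((u^T *m colv z.1) 0 0 + c)).
have gE z : cos ((u^T *m colv (f z)) 0 0 + c) = g z.
  rewrite vec_ofK mulmxDr -scalemxAr /g mxE; congr cos.
  by rewrite [X in _ + X + _]mxE; ring.
have mg : measurable_fun [set: vecspace R d * measurableTypeR R] g.
  apply: measurable_cos_fun; apply: measurable_funD.
    by apply: measurable_funM => //; exact: measurable_snd.
  apply: measurable_funD => //.
  apply: (measurableT_comp (measurable_linear_form u)); exact: measurable_fst.
have ig (P : probability (vecspace R d * measurableTypeR R)%type R) :
    P.-integrable setT (EFin \o g).
  by apply: (@bounded_integrable _ _ _ P _ 1) => // x; exact: cos_max.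
rewrite (@Rintegral_image_prob _ _ _ _ _ _ mf _
    (fun x => cos ((u^T *m colv x) 0 0 + c)))//; last 2 first.
- apply: measurable_cos_fun; apply: measurable_funD => //.
  exact: measurable_linear_form.
- by rewrite (_ : _ \o f = g); [exact: ig|apply/funext => z; exact: gE].
under eq_Rintegral do rewrite gE.
rewrite /Rintegral -[X in fine X](integral12_prod_meas1 (ig _)) /fubini_F.
pose e := expR (- (((u^T *m b) 0 0) ^+ 2 / 2)).
under eq_integral => x _.
  rewrite (_ : (\int[_]_y _)%E = (cos ((u^T *m colv x) 0 0 + c) * e)%:E); last first.
    have := @integral_cos_normal_law R 0 1 ((u^T *m b) 0 0)
      ((u^T *m colv x) 0 0 + c) ler01.
    rewrite mulr0 add0r mul1r -/e => <-; rewrite fineK//.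
    apply: integrable_fin_num => //; apply: integrable_cos; exact: measurable_affine.
  over.
rewrite -/(Rintegral _ _ _) RintegralZr//; last first.
  apply: integrable_cos; apply: measurable_funD => //.
  exact: measurable_linear_form.
rewrite IH -mulrA -expRD; congr (_ * expR _).
rewrite big_cons mulmxDr mulmxDl [X in _ = - (X / 2)]mxE.
by rewrite quad_rank1; ring.
Qed.

Lemma gaussian_exists (m : 'cV[R]_d) (S : 'M[R]_d) : psd S ->
  exists mu : probability (vecspace R d) R, gaussian mu m S.
Proof.
move=> S0; have [s Ss] := psd_sum_rank1 S0.
have [mu hmu] := gaussian_rank1_exists m s.
by exists mu; apply/(gaussianP _ _ S0) => u c; rewrite hmu Ss.
Qed.

End Existence.

(** * First two moments from the trigonometric transform *)

Section SinBounds.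
Context (R : realType).
Implicit Types x y : R.

Lemma sin_MVT y : 0 <= y -> exists2 c, 0 <= c <= y & sin y = cos c * y.
Proof.
move=> y0; have cs : {within `[0, y], continuous (@sin R)}.
  by apply: continuous_subspaceT; exact: continuous_sin.
have [c] := @MVT_segment R sin cos 0 y y0 (fun x _ => is_derive_sin x) cs.
by rewrite in_itv/= sin0 !subr0 => cy e; exists c.
Qed.

Lemma norm_sin_le x : `|sin x| <= `|x|.
Proof.
have H y : 0 <= y -> `|sin y| <= `|y|.
  move=> /sin_MVT[c _ ->]; rewrite normrM ler_piMl//.
  by rewrite ler_norml cos_geN1 cos_le1.
have [x0|x0] := lerP 0 x; first exact: H.
by rewrite -normrN -sinN -[leRHS]normrN; apply: H; rewrite oppr_ge0 ltW.
Qed.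

Lemma cosE_half x : 1 - cos x = 2 * sin (x / 2) ^+ 2.
Proof.
have -> : cos x = cos ((x / 2) *+ 2) by congr cos; rewrite -mulr_natr; field.
by rewrite cos_mulr2n cos2sin2 -mulr_natr; ring.
Qed.

Lemma cos_ge x : 1 - x ^+ 2 / 2 <= cos x.
Proof.
have := cosE_half x.
have := norm_sin_le (x / 2); rewrite -ler_sqr ?nnegrE// -!normrX.
rewrite !ger0_norm ?sqr_ge0// => h e.
have -> : x ^+ 2 / 2 = 2 * (x / 2) ^+ 2 by field.
lra.
Qed.

(** The mean value theorem writes sin y = y cos c with c between 0 and y, and
    cosine is quadratically close to 1. *)
Lemma cvg_natM_sin x : n.+1%:R * sin (x / n.+1%:R) @[n --> \oo] --> x.
Proof.
have H y : 0 <= y -> n.+1%:R * sin (y / n.+1%:R) @[n --> \oo] --> y.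
  move=> y0.
  apply: (@squeeze_cvgr _ _ _ _ (fun n => y - y ^+ 3 / 2 * n.+1%:R^-1) (cst y)).
  - apply: nearW => n /=.
    have n0 : 0 < n.+1%:R :> R by [].
    have yn0 : 0 <= y / n.+1%:R by rewrite divr_ge0.
    have [c /andP[c0 cy] ->] := sin_MVT yn0.
    have -> : n.+1%:R * (cos c * (y / n.+1%:R)) = y * cos c by field.
    have c1 := cos_le1 c; apply/andP; split; last by rewrite ler_piMr.
    have c2 := cos_ge c.
    have cy2 : c ^+ 2 <= y ^+ 2 * n.+1%:R^-1.
      apply: (@le_trans _ _ ((y / n.+1%:R) ^+ 2)).
        by rewrite ler_sqr.
      rewrite exprMn; apply: ler_wpM2l; first exact: sqr_ge0.
      by rewrite expr2 ler_piMl ?invr_ge0// invf_le1// ler1n.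
    apply: (@le_trans _ _ (y * (1 - c ^+ 2 / 2))); last exact: ler_wpM2l.
    have -> : y ^+ 3 / 2 * n.+1%:R^-1 = y * (y ^+ 2 * n.+1%:R^-1 / 2) by field.
    move: (y ^+ 2 * _) cy2 => q cy2.
    have -> : y - y * (q / 2) = y * (1 - q / 2) by ring.
    by apply: ler_wpM2l => //; lra.
  - have h : y - y ^+ 3 / 2 * n.+1%:R^-1 @[n --> \oo] --> y - y ^+ 3 / 2 * 0.
      apply: cvgB; first exact: cvg_cst.
      by apply: cvgM; [exact: cvg_cst|exact: cvg_harmonic].
    by rewrite mulr0 subr0 in h.
  - exact: cvg_cst.
have [x0|x0] := lerP 0 x; first exact: H.
have nx0 : 0 <= - x by rewrite oppr_ge0 ltW.
have h : - (n.+1%:R * sin (- x / n.+1%:R)) @[n --> \oo] --> - - x.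
  by apply: cvgN; exact: H.
rewrite opprK in h; apply: cvg_trans h; apply: near_eq_cvg; apply: nearW => n.
by rewrite mulNr sinN mulrN opprK.
Qed.

(** The derivative at 0 of the exponential, from 1 - w <= exp (- w) <= 1 / (1 + w). *)
Lemma cvg_sqrnat_onem_expR (v : R) : 0 <= v ->
  2 * n.+1%:R ^+ 2 * (1 - expR (- (v * (n.+1%:R^-1) ^+ 2 / 2))) @[n --> \oo] --> v.
Proof.
move=> v0.
apply: (@squeeze_cvgr _ _ _ _ (fun n => v - v ^+ 2 / 2 * n.+1%:R^-1) (cst v)).
- apply: nearW => n /=; have n0 : 0 < n.+1%:R :> R by [].
  have n1 : 1 <= n.+1%:R :> R by rewrite ler1n.
  set k := n.+1%:R in n0 n1 *; pose w := v * k^-1 ^+ 2 / 2.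
  have w0 : 0 <= w by rewrite /w !mulr_ge0 ?exprn_ge0// invr_ge0 ltW.
  have vw : v = 2 * k ^+ 2 * w by rewrite /w; field; exact: lt0r_neq0.
  rewrite -/w; have e1 := expR_ge1Dx (- w).
  have k2 : 0 <= 2 * k ^+ 2 by rewrite mulr_ge0// sqr_ge0.
  have e2 : expR (- w) * (1 + w) <= 1.
    by rewrite expRN mulrC ler_pdivrMr ?expR_gt0// mul1r; exact: expR_ge1Dx.
  have e0 := expR_gt0 (- w); move: (expR (- w)) e0 e1 e2 => e e0 e1 e2.
  apply/andP; split; last by rewrite [leRHS]vw; apply: ler_wpM2l => //; lra.
  apply: (@le_trans _ _ (2 * k ^+ 2 * (w - w ^+ 2))); last first.
    by apply: ler_wpM2l => //; nra.
  rewrite mulrBr -vw lerD2l lerN2.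
  have -> : 2 * k ^+ 2 * w ^+ 2 = v ^+ 2 / 2 * (k^-1 * k^-1).
    by rewrite /w; field; exact: lt0r_neq0.
  apply: ler_wpM2l; first by rewrite divr_ge0// sqr_ge0.
  by rewrite ler_piMl ?invr_ge0// ?invf_le1// ltW.
- have h : v - v ^+ 2 / 2 * n.+1%:R^-1 @[n --> \oo] --> v - v ^+ 2 / 2 * 0.
    apply: cvgB; first exact: cvg_cst.
    by apply: cvgM; [exact: cvg_cst|exact: cvg_harmonic].
  by rewrite mulr0 subr0 in h.
- exact: cvg_cst.
Qed.

End SinBounds.

Section Moments.
Context d (T : measurableType d) (R : realType) (P : probability T R).
Variables (X : T -> R) (a v : R).
Hypothesis mX : measurable_fun [set: T] X.
Hypothesis v0 : 0 <= v.
Hypothesis cosX : forall t c,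
  \int[P]_x cos (t * X x + c) = cos (t * a + c) * expR (- (v * t ^+ 2 / 2)).

(** Bounded approximation of y ^ 2 from below, with explicit integral under
    [cosX]. *)
Let h n (y : R) := 2 * n.+1%:R ^+ 2 * (1 - cos (y / n.+1%:R)).

Let hE n y : h n y = 4 * (n.+1%:R * sin (y / 2 / n.+1%:R)) ^+ 2.
Proof.
rewrite /h cosE_half (_ : y / n.+1%:R / 2 = y / 2 / n.+1%:R); last by field.
ring.
Qed.

Let h_ge0 n y : 0 <= h n y.
Proof. by rewrite hE mulr_ge0// sqr_ge0. Qed.

Let h_le n y : h n y <= y ^+ 2.
Proof.
rewrite hE (_ : y ^+ 2 = 4 * (n.+1%:R * (y / 2 / n.+1%:R)) ^+ 2); last by field.
apply: ler_wpM2l => //; rewrite !exprMn; apply: ler_wpM2l; first exact: sqr_ge0.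
rewrite -[leLHS]ger0_norm ?sqr_ge0// normrX.
rewrite -[leRHS]ger0_norm; last by rewrite -!exprMn sqr_ge0.
by rewrite -!exprMn [leRHS]normrX ler_sqr ?nnegrE//; exact: norm_sin_le.
Qed.

Let cvg_h y : h n y @[n --> \oo] --> y ^+ 2.
Proof.
under eq_fun do rewrite hE.
have -> : y ^+ 2 = 4 * (y / 2 * (y / 2)) by field.
apply: cvgM; first exact: cvg_cst.
have hs := @cvg_natM_sin R (y / 2).
by under eq_fun do rewrite expr2; apply: cvgM; exact: hs.
Qed.

Let mh n : measurable_fun [set: T] (fun x => h n (X x)).
Proof.
apply: measurable_funM => //; apply: measurable_funB => //.
by apply: measurable_cos_fun; exact: measurable_funM.
Qed.

Let int_h n : \int[P]_x h n (X x) = h n a +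
  cos (a / n.+1%:R) * (2 * n.+1%:R ^+ 2 * (1 - expR (- (v * (n.+1%:R^-1) ^+ 2 / 2)))).
Proof.
have mc : measurable_fun [set: T] (fun x => X x / n.+1%:R) by exact: measurable_funM.
have ic := integrable_cos P mc.
have i1 : P.-integrable [set: T] (EFin \o (fun=> 1 : R)).
  by apply: (@bounded_integrable _ _ _ P _ 1) => // x; rewrite normr1.
rewrite /h RintegralZl//; last exact: integrableB i1 ic.
have PT : fine (P [set: T]) = 1 by rewrite [X in fine X]probability_setT.
rewrite RintegralB// Rintegral_cst// PT mulr1.
have := cosX n.+1%:R^-1 0; under eq_Rintegral do rewrite addr0 mulrC.
by rewrite addr0 [_ * a]mulrC => ->; ring.
Qed.

Let cvg_int_h : \int[P]_x h n (X x) @[n --> \oo] --> a ^+ 2 + v.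
Proof.
under eq_fun do rewrite int_h.
have ca : a / n.+1%:R @[n --> \oo] --> (0 : R).
  have ca : a / n.+1%:R @[n --> \oo] --> a * 0.
    by apply: cvgM; [exact: cvg_cst|exact: cvg_harmonic].
  by rewrite mulr0 in ca.
have cc : cos (a / n.+1%:R) @[n --> \oo] --> cos (0 : R).
  by apply: (cvg_comp _ _ ca); exact: continuous_cos.
have -> : a ^+ 2 + v = a ^+ 2 + cos 0 * v by rewrite cos0 mul1r.
by apply: cvgD => //; apply: cvgM => //; exact: cvg_sqrnat_onem_expR.
Qed.

(** The functions h n tend to the square from below and their integrals are
    explicit, so Fatou's lemma bounds the second moment. *)
Lemma integrable_sqr_of_cos : P.-integrable [set: T] (EFin \o (fun x => X x ^+ 2)).
Proof.
have mX2 : measurable_fun [set: T] (fun x => X x ^+ 2) by exact: measurable_funX.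
apply/integrableP; split; first exact/measurable_EFinP.
have mhE n : measurable_fun [set: T] (fun x => (h n (X x))%:E).
  exact/measurable_EFinP.
have h0 n x : [set: T] x -> (0 <= (h n (X x))%:E)%E by rewrite lee_fin h_ge0.
have einfE (u : nat -> \bar R) l : u n @[n --> \oo] --> l -> limn_einf u = l.
  by move=> /cvg_limn_einf_sup[].
have hX x : limn_einf (fun n => (h n (X x))%:E) = (X x ^+ 2)%:E.
  by apply: einfE; apply: cvg_EFin; [exact: nearW|exact: cvg_h].
have ih n : P.-integrable [set: T] (EFin \o (fun x => h n (X x))).
  apply: (@bounded_integrable _ _ _ P _ (4 * n.+1%:R ^+ 2)) => // x.
  rewrite ger0_norm// hE; apply: ler_wpM2l => //.
  rewrite exprMn; apply: ler_piMr; first exact: sqr_ge0.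
  by rewrite sin2cos2 gerBl sqr_ge0.
have hI : limn_einf (fun n => \int[P]_x (h n (X x))%:E)%E = (a ^+ 2 + v)%:E.
  rewrite (_ : (fun n => _) = (fun n => (\int[P]_x h n (X x))%:E)).
    by apply: einfE; apply: cvg_EFin; [exact: nearW|exact: cvg_int_h].
  apply/funext => n; rewrite fineK//; apply: integrable_fin_num => //; exact: ih.
have := fatou P measurableT mhE h0.
rewrite hI; under eq_integral do rewrite hX.
have absE x : `|(X x ^+ 2)%:E|%E = (X x ^+ 2)%:E by rewrite gee0_abs ?lee_fin ?sqr_ge0.
under [in X in _ -> X]eq_integral do rewrite absE.
by move=> /le_lt_trans; apply; rewrite ltry.
Qed.

Lemma Rintegral_sqr_of_cos : \int[P]_x (X x ^+ 2) = a ^+ 2 + v.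
Proof.
have c := @dominated_cvg_Rintegral _ _ _ P (fun n x => h n (X x))
  (fun x => X x ^+ 2) (fun x => X x ^+ 2) mh integrable_sqr_of_cos.
rewrite -(cvg_lim _ (c _ _))//; last first.
  by move=> n x; rewrite ger0_norm.
exact: cvg_lim.
Qed.

Lemma integrable_of_sqr : P.-integrable [set: T] (EFin \o X).
Proof.
have i1 : P.-integrable [set: T] (EFin \o (fun=> 1 : R)).
  by apply: (@bounded_integrable _ _ _ P _ 1) => // x; rewrite normr1.
have i2 := integrableD measurableT i1 integrable_sqr_of_cos.
apply: le_integrable i2 => //; first exact/measurable_EFinP.
move=> x _; rewrite lee_fin [leRHS]ger0_norm; last by rewrite addr_ge0 ?sqr_ge0.
rewrite -[X x ^+ 2]ger0_norm ?sqr_ge0// normrX.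
by have := sqr_ge0 (`|X x| - 1); have := normr_ge0 (X x); nra.
Qed.

(** Same idea as for the square, with n sin (X / n), which tends to X and is
    dominated by |X|. *)
Lemma Rintegral_of_cos : \int[P]_x X x = a.
Proof.
pose g n x := n.+1%:R * sin (X x / n.+1%:R).
have ms n : measurable_fun [set: T] (fun x => sin (X x / n.+1%:R)).
  apply: (measurableT_comp (f := @sin R)).
    by apply: continuous_measurable_fun; exact: continuous_sin.
  exact: measurable_funM.
have isn n : P.-integrable [set: T] (EFin \o (fun x => sin (X x / n.+1%:R))).
  by apply: (@bounded_integrable _ _ _ P _ 1) => // x; exact: sin_max.
have mg n : measurable_fun [set: T] (g n) by exact: measurable_funM.
have ig := integrable_norm integrable_of_sqr.
have gb n x : `|g n x| <= `|X x|.
  rewrite /g normrM ger0_norm//; apply: (@le_trans _ _ (n.+1%:R * `|X x / n.+1%:R|)).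
    by apply: ler_wpM2l => //; exact: norm_sin_le.
  by rewrite normrM [`|_^-1|]ger0_norm// mulrCA divff// mulr1.
have c := dominated_cvg_Rintegral mg ig gb (fun x => @cvg_natM_sin R (X x)).
rewrite -(cvg_lim _ c)//; apply: cvg_lim => //.
pose E n := expR (- (v * (n.+1%:R^-1) ^+ 2 / 2)).
have ge n : \int[P]_x g n x = n.+1%:R * sin (a / n.+1%:R) * E n.
  rewrite /g RintegralZl; [|by []|exact: isn]; rewrite -mulrA; congr (_ * _).
  (* The phase - pi / 2 turns the cosine into a sine. *)
  have := cosX n.+1%:R^-1 (- (pi / 2)).
  under eq_Rintegral do rewrite cosBpihalf mulrC.
  by rewrite cosBpihalf [_ * a]mulrC.
under eq_fun do rewrite ge.
have -> : a = a * expR 0 by rewrite expR0 mulr1.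
apply: cvgM; first by rewrite expR0 mulr1; exact: cvg_natM_sin.
have cv : - (v * n.+1%:R^-1 ^+ 2 / 2) @[n --> \oo] --> - (v * (0 * 0) / 2).
  apply: cvgN; apply: cvgM; last exact: cvg_cst.
  apply: cvgM; first exact: cvg_cst.
  by under eq_fun do rewrite expr2; apply: cvgM; exact: cvg_harmonic.
rewrite !mulr0 mul0r oppr0 in cv.
by apply: (cvg_comp _ _ cv); exact: continuous_expR.
Qed.

End Moments.

(** * Second moment matrices *)

Section SecondMoments.
Context dT (T : measurableType dT) (R : realType) (P : probability T R).

Definition square_integrable p (W : T -> 'cV[R]_p) := forall i,
  measurable_fun [set: T] (fun x => W x i 0) /\
  P.-integrable [set: T] (EFin \o (fun x => W x i 0 ^+ 2)).

Definition mean_vec p (W : T -> 'cV[R]_p) : 'cV[R]_p := \col_i \int[P]_x W x i 0.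

Definition moment_mx p (W : T -> 'cV[R]_p) : 'M[R]_p :=
  \matrix_(i, j) \int[P]_x (W x *m (W x)^T) i j.

Lemma integrable_scale (a : R) (f : T -> R) :
  P.-integrable [set: T] (EFin \o f) ->
  P.-integrable [set: T] (EFin \o (fun x => a * f x)).
Proof. by move=> intf; exact: (integrableZl measurableT a intf). Qed.

Lemma integrable_mul (f g : T -> R) :
  measurable_fun [set: T] f -> measurable_fun [set: T] g ->
  P.-integrable [set: T] (EFin \o (fun x => f x ^+ 2)) ->
  P.-integrable [set: T] (EFin \o (fun x => g x ^+ 2)) ->
  P.-integrable [set: T] (EFin \o (fun x => f x * g x)).
Proof.
move=> mf mg if2 ig2; have ifg := integrableD measurableT if2 ig2.
apply: le_integrable ifg => //.
  by apply/measurable_EFinP; exact: measurable_funM.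
move=> x _; rewrite lee_fin [leRHS]ger0_norm; last by rewrite addr_ge0 ?sqr_ge0.
rewrite ler_norml; have := sqr_ge0 (f x + g x); have := sqr_ge0 (f x - g x).
have := sqr_ge0 (f x); have := sqr_ge0 (g x); nra.
Qed.

Section Vector.
Context p (W : T -> 'cV[R]_p) (W2 : square_integrable W).

Lemma integrable_coord_mul i j :
  P.-integrable [set: T] (EFin \o (fun x => W x i 0 * W x j 0)).
Proof. by have [mi si] := W2 i; have [mj sj] := W2 j; exact: integrable_mul. Qed.

Lemma integrable_coord i : P.-integrable [set: T] (EFin \o (fun x => W x i 0)).
Proof.
have [mi si] := W2 i.
have i1 : P.-integrable [set: T] (EFin \o (fun=> 1 ^+ 2 : R)).
  by apply: (@bounded_integrable _ _ _ P _ 1) => // x; rewrite expr1n normr1.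
have mc : measurable_fun [set: T] (fun=> 1 : R) by exact: measurable_cst.
have := integrable_mul mi mc si i1.
by under [X in EFin \o X]eq_fun do rewrite mulr1.
Qed.

Lemma moment_mxE i j : moment_mx W i j = \int[P]_x (W x i 0 * W x j 0).
Proof.
by rewrite mxE; apply: eq_Rintegral => x _; rewrite mxE big_ord1 [X in _ * X]mxE.
Qed.

Lemma moment_mx_sym : (moment_mx W)^T = moment_mx W.
Proof.
apply/matrixP => i j; rewrite mxE !moment_mxE.
by apply: eq_Rintegral => x _; rewrite mulrC.
Qed.

Lemma integrable_sum_fun (I : finType) (f : I -> T -> R) :
  (forall i, P.-integrable [set: T] (EFin \o f i)) ->
  P.-integrable [set: T] (EFin \o (fun x => \sum_i f i x)).
Proof.
move=> intf.
rewrite (_ : EFin \o _ = fun x => (\sum_i (EFin \o f i) x)%E).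
  by apply: integrable_sum => //= i _; exact: intf.
by apply/funext => x /=; rewrite sumEFin.
Qed.

Lemma Rintegral_sum_fun (I : finType) (f : I -> T -> R) :
  (forall i, P.-integrable [set: T] (EFin \o f i)) ->
  \int[P]_x (\sum_i f i x) = \sum_i \int[P]_x f i x.
Proof.
move=> intf; rewrite -(big_enum _ _ _ (fun i => \int[P]_x f i x))/=.
under eq_Rintegral => x _ do rewrite -(big_enum _ _ _ (fun i => f i x))/=.
elim: (enum I) => [|i s IH].
  under eq_Rintegral do rewrite big_nil.
  by rewrite big_nil Rintegral_cst// mul0r.
under eq_Rintegral do rewrite big_cons.
rewrite big_cons RintegralD// ?IH//.
rewrite (_ : EFin \o _ = fun x => (\sum_(i <- s) (EFin \o f i) x)%E).
  by apply: integrable_sum => //= j _; exact: intf.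
by apply/funext => x /=; rewrite sumEFin.
Qed.

Lemma square_integrable_mulmx q (L : 'M[R]_(q, p)) :
  square_integrable (fun x => L *m W x).
Proof.
have mL i : measurable_fun [set: T] (fun x => (L *m W x) i 0).
  under eq_fun do rewrite mxE.
  by apply: measurable_sum => j; apply: measurable_funM => //; case: (W2 j).
move=> i; split => //.
rewrite (_ : (fun x => _) =
    (fun x => \sum_k \sum_j L i k * (L i j * (W x k 0 * W x j 0)))).
  apply: integrable_sum_fun => k; apply: integrable_sum_fun => j.
  by do 2 apply: integrable_scale; exact: integrable_coord_mul.
apply/funext => x; rewrite mxE expr2 mulr_suml; apply: eq_bigr => k _.
by rewrite mulr_sumr; apply: eq_bigr => j _; ring.
Qed.

Lemma moment_mx_mulmx q (L : 'M[R]_(q, p)) :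
  moment_mx (fun x => L *m W x) = L *m moment_mx W *m L^T.
Proof.
apply/matrixP => i j; rewrite mxE.
transitivity (\int[P]_x (\sum_k \sum_l L i k * (L j l * (W x k 0 * W x l 0)))).
  apply: eq_Rintegral => x _; rewrite mxE big_ord1 !mxE mulr_suml.
  apply: eq_bigr => k _; rewrite mulr_sumr; apply: eq_bigr => l _; ring.
have ikl k l : P.-integrable [set: T]
    (EFin \o (fun x => L i k * (L j l * (W x k 0 * W x l 0)))).
  by do 2 apply: integrable_scale; exact: integrable_coord_mul.
rewrite Rintegral_sum_fun; last by move=> k; exact: integrable_sum_fun.
rewrite mxE; under [RHS]eq_bigr do rewrite mxE mulr_suml.
rewrite exchange_big/=; apply: eq_bigr => k _.
rewrite Rintegral_sum_fun//; apply: eq_bigr => l _.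
rewrite RintegralZl//; last first.
  by apply: integrable_scale; exact: integrable_coord_mul.
rewrite RintegralZl//; last exact: integrable_coord_mul.
by rewrite moment_mxE mxE; ring.
Qed.

Lemma mean_vec_mulmx q (L : 'M[R]_(q, p)) :
  mean_vec (fun x => L *m W x) = L *m mean_vec W.
Proof.
apply/matrixP => i j; rewrite !mxE.
under eq_Rintegral do rewrite mxE.
rewrite Rintegral_sum_fun; last first.
  by move=> k; apply: integrable_scale; exact: integrable_coord.
apply: eq_bigr => k _; rewrite mxE RintegralZl//; exact: integrable_coord.
Qed.

Lemma psd_moment_mx : psd (moment_mx W).
Proof.
split; first exact: moment_mx_sym.
move=> v; rewrite -[v in _ *m v]trmxK -moment_mx_mulmx mxE.
by apply: Rintegral_ge0 => x _; rewrite mxE big_ord1 [X in _ * X]mxE -expr2 sqr_ge0.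
Qed.

End Vector.

(** The quadratic form at v is the variance of <v, W>. *)
Lemma psd_covariance p (W : T -> 'cV[R]_p) : square_integrable W ->
  psd (moment_mx W - mean_vec W *m (mean_vec W)^T).
Proof.
move=> W2; split.
  by rewrite linearB/= trmx_mul trmxK moment_mx_sym.
move=> v; pose Y x := (v^T *m W x) 0 0; pose e := (v^T *m mean_vec W) 0 0.
have [mY iY2] := square_integrable_mulmx W2 v^T 0.
have iY := integrable_coord (square_integrable_mulmx W2 v^T) 0.
have EY : \int[P]_x Y x = e.
  by rewrite /e -mean_vec_mulmx// mxE.
have EY2 : \int[P]_x Y x ^+ 2 = (v^T *m moment_mx W *m v) 0 0.
  rewrite -[in X in _ *m X](trmxK v) -moment_mx_mulmx// moment_mxE.
  by apply: eq_Rintegral => x _; rewrite expr2.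
have E0 : 0 <= \int[P]_x (Y x - e) ^+ 2.
  by apply: Rintegral_ge0 => x _; exact: sqr_ge0.
have ie : P.-integrable [set: T] (EFin \o (fun=> e ^+ 2 : R)).
  exact: (@bounded_integrable _ _ _ P _ `|e ^+ 2|).
have iY' : P.-integrable [set: T] (EFin \o (fun x => 2 * e * Y x)).
  exact: integrable_scale.
have iB : P.-integrable [set: T] (EFin \o (fun x => Y x ^+ 2 - 2 * e * Y x)).
  exact: (integrableB measurableT iY2 iY').
have EE : \int[P]_x (Y x - e) ^+ 2 = \int[P]_x Y x ^+ 2 - e ^+ 2.
  have PT : fine (P [set: T]) = 1 by rewrite [X in fine X]probability_setT.
  under eq_Rintegral => x _.
    rewrite (_ : _ ^+ 2 = (Y x ^+ 2 - 2 * e * Y x) + e ^+ 2); last by ring.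
    over.
  rewrite RintegralD// RintegralB// RintegralZl// EY Rintegral_cst// PT; ring.
rewrite EE EY2 in E0.
rewrite mulmxBr mulmxBl [X in 0 <= X]mxE [X in _ + X]mxE.
by rewrite quad_rank1.
Qed.

End SecondMoments.

(** * Gaussian vectors: moments and linear images *)

Section GaussianMoments.
Context (R : realType) (d : nat).

Section Law.
Variables (mu : probability (vecspace R d) R) (m : 'cV[R]_d) (S : 'M[R]_d).
Hypotheses (S0 : psd S) (g : gaussian mu m S).

Let form_cos := cos_transformZ ((gaussianP mu m S0).1 g).

Let quad_ge0 (u : 'cV[R]_d) : 0 <= (u^T *m S *m u) 0 0.
Proof. by case: S0. Qed.

Lemma square_integrable_gaussian : square_integrable mu (@colv R d).
Proof.
move=> i; have := integrable_sqr_of_cos (measurable_linear_form (delta_mx i 0))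
  (quad_ge0 (delta_mx i 0)) (form_cos (delta_mx i 0)).
have := measurable_linear_form (delta_mx i 0 : 'cV[R]_d).
have -> : (fun x : vecspace R d => ((delta_mx i 0 : 'cV[R]_d)^T *m colv x) 0 0) =
    (fun x => colv x i 0) by apply/funext => x; rewrite linear_form_delta.
have -> : (fun x : vecspace R d => ((delta_mx i 0 : 'cV[R]_d)^T *m colv x) 0 0 ^+ 2) =
    (fun x => colv x i 0 ^+ 2) by apply/funext => x; rewrite linear_form_delta.
by [].
Qed.

Lemma mean_gaussian : mean_vec mu (@colv R d) = m.
Proof.
apply/matrixP => i j; rewrite ord1 mxE.
have := Rintegral_of_cos (measurable_linear_form (delta_mx i 0))
  (quad_ge0 (delta_mx i 0)) (form_cos (delta_mx i 0)).
rewrite linear_form_delta => <-; by apply: eq_Rintegral => x _; rewrite linear_form_delta.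
Qed.

(** Both matrices are symmetric and their quadratic forms agree, being the second
    moments of the linear forms <v, x>. *)
Lemma moment_mx_gaussian : moment_mx mu (@colv R d) = S + m *m m^T.
Proof.
have [symS _] := S0.
apply: quad_mx_inj; first exact: moment_mx_sym.
  by rewrite linearD/= trmx_mul trmxK symS.
move=> v.
transitivity (((v^T *m m) 0 0) ^+ 2 + (v^T *m S *m v) 0 0).
  rewrite -(Rintegral_sqr_of_cos (measurable_linear_form v) (quad_ge0 v) (form_cos v)).
  have -> : v^T *m moment_mx mu (@colv R d) *m v =
      v^T *m moment_mx mu (@colv R d) *m (v^T)^T by rewrite trmxK.
  rewrite -moment_mx_mulmx; last exact: square_integrable_gaussian.
  by rewrite moment_mxE; apply: eq_Rintegral => x _; rewrite expr2.
by rewrite mulmxDr mulmxDl [RHS]mxE addrC quad_rank1.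
Qed.

End Law.

End GaussianMoments.

Section GaussianImage.
Context (R : realType) (p q : nat) (L : 'M[R]_(q, p)).

Lemma measurable_mulmx_colv i :
  measurable_fun [set: vecspace R p] (fun x => (L *m colv x) i 0).
Proof.
under eq_fun do rewrite mxE; apply: measurable_sum => j.
by apply: measurable_funM => //; under eq_fun do rewrite mxE; exact: measurable_coord.
Qed.

Lemma measurable_linear_image :
  measurable_fun [set: vecspace R p] (fun x => vec_of (L *m colv x)).
Proof. by apply: measurable_vec_of; exact: measurable_mulmx_colv. Qed.

(** On transforms, the image by [L] replaces u by L^T u. *)
Lemma gaussian_linear_image (mu : probability (vecspace R p) R) m S :
  psd S -> psd (L *m S *m L^T) -> gaussian mu m S ->
  gaussian (image_prob measurable_linear_image mu) (L *m m) (L *m S *m L^T).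
Proof.
move=> S0 LS0 /(gaussianP _ _ S0) g; apply/(gaussianP _ _ LS0) => u c.
rewrite (@Rintegral_image_prob _ _ _ _ _ _ measurable_linear_image mu
  (fun x => cos ((u^T *m colv x) 0 0 + c))); last 2 first.
- apply: measurable_cos_fun; apply: measurable_funD => //.
  exact: measurable_linear_form.
- apply: integrable_cos; apply: measurable_funD => //.
  exact: (measurableT_comp (measurable_linear_form u) measurable_linear_image).
have eL (x : 'cV[R]_p) : u^T *m (L *m x) = (L^T *m u)^T *m x.
  by rewrite trmx_mul trmxK mulmxA.
have := g (L^T *m u) c; rewrite -eL.
have -> : (L^T *m u)^T *m S *m (L^T *m u) = u^T *m (L *m S *m L^T) *m u.
  by rewrite trmx_mul trmxK !mulmxA.
by move=> <-; apply: eq_Rintegral => x _; rewrite vec_ofK eL.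
Qed.

End GaussianImage.

(** * Couplings and admissible cross-covariances *)

Section Blocks.
Context (R : realType) (d : nat).
Implicit Types (K S : 'M[R]_d) (a b : 'cV[R]_d).

Definition fst_mx : 'M[R]_(d, d + d) := row_mx 1%:M 0.
Definition snd_mx : 'M[R]_(d, d + d) := row_mx 0 1%:M.

Lemma fst_mxE a b : fst_mx *m col_mx a b = a.
Proof. by rewrite mul_row_col mul1mx mul0mx addr0. Qed.

Lemma snd_mxE a b : snd_mx *m col_mx a b = b.
Proof. by rewrite mul_row_col mul1mx mul0mx add0r. Qed.

Lemma fst_block S0 K K' S1 : fst_mx *m block_mx S0 K K' S1 *m fst_mx^T = S0.
Proof.
rewrite mul_row_block !mul1mx !mul0mx !addr0 tr_row_mx mul_row_col.
by rewrite trmx1 trmx0 mulmx1 mulmx0 addr0.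
Qed.

Lemma snd_block S0 K K' S1 : snd_mx *m block_mx S0 K K' S1 *m snd_mx^T = S1.
Proof.
rewrite mul_row_block !mul1mx !mul0mx !add0r tr_row_mx mul_row_col.
by rewrite trmx1 trmx0 mulmx1 mulmx0 add0r.
Qed.

(** The map (x, y) |-> y - x applied to the second moment matrix of a pair with
    means a, b and covariance blocks S0, K, S1. *)
Lemma difference_block S0 K S1 a b :
  (snd_mx - fst_mx) *m (block_mx S0 K K^T S1 + col_mx a b *m (col_mx a b)^T)
    *m (snd_mx - fst_mx)^T =
  (b - a) *m (b - a)^T + S0 + S1 - K - K^T.
Proof.
have LE : snd_mx - fst_mx = row_mx (- 1%:M) 1%:M.
  by rewrite /snd_mx /fst_mx opp_row_mx add_row_mx sub0r oppr0 addr0.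
have L2 : (snd_mx - fst_mx) *m col_mx a b = b - a.
  by rewrite mulmxBl snd_mxE fst_mxE.
rewrite mulmxDr mulmxDl.
have -> : (snd_mx - fst_mx) *m (col_mx a b *m (col_mx a b)^T) *m (snd_mx - fst_mx)^T =
    (b - a) *m (b - a)^T.
  by rewrite -L2 trmx_mul !mulmxA.
rewrite LE mul_row_block tr_row_mx mul_row_col linearN/= trmx1 !mulmxN !mulNmx.
rewrite !mul1mx !mulmx1.
by apply/matrixP => i j; rewrite !mxE; ring.
Qed.

End Blocks.

Section Couplings.
Context (R : realType) (d : nat).
Variables (mu nu : probability (vecspace R d) R) (m0 m1 : 'cV[R]_d).
Variables (S0 S1 : 'M[R]_d).
Hypotheses (psdS0 : psd S0) (psdS1 : psd S1).
Hypotheses (hmu : gaussian mu m0 S0) (hnu : gaussian nu m1 S1).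

Definition cost_mx (K : 'M[R]_d) : 'M[R]_d :=
  (m1 - m0) *m (m1 - m0)^T + S0 + S1 - K - K^T.

Definition joint_vec (z : vecspace R d * vecspace R d) : 'cV[R]_(d + d) :=
  col_mx (colv z.1) (colv z.2).

Let joint_vecE z : colv z.2 - colv z.1 = (snd_mx R d - fst_mx R d) *m joint_vec z.
Proof. by rewrite mulmxBl snd_mxE fst_mxE. Qed.

Lemma displacement_mxE (pi : probability (vecspace R d * vecspace R d)%type R) :
  square_integrable pi joint_vec ->
  displacement_mx pi = (snd_mx R d - fst_mx R d) *m moment_mx pi joint_vec
    *m (snd_mx R d - fst_mx R d)^T.
Proof.
move=> J2; rewrite -moment_mx_mulmx//; apply/matrixP => i j; rewrite !mxE.
by apply: eq_Rintegral => z _; rewrite -joint_vecE.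
Qed.

(** The diagonal blocks of the second moment matrix only involve one marginal
    each; the means and the square integrability do too. *)
Lemma coupling_marginals pi : couplings mu nu pi ->
  [/\ square_integrable pi joint_vec,
      mean_vec pi joint_vec = col_mx m0 m1,
      ulsubmx (moment_mx pi joint_vec) = S0 + m0 *m m0^T &
      drsubmx (moment_mx pi joint_vec) = S1 + m1 *m m1^T].
Proof.
move=> [pi1 pi2].
have mu2 := square_integrable_gaussian psdS0 hmu.
have nu2 := square_integrable_gaussian psdS1 hnu.
have t1 g := @integrable_preimage _ _ _ _ R pi mu fst g measurable_fst ^~ pi1.
have t2 g := @integrable_preimage _ _ _ _ R pi nu snd g measurable_snd ^~ pi2.
have mc i : measurable_fun [set: vecspace R d] (fun x => colv x i 0).
  by case: (mu2 i).
have J2 : square_integrable pi joint_vec.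
  move=> i; split.
    rewrite -(splitK i); case: fintype.split => k /=.
      under eq_fun do rewrite col_mxEu.
      exact: (measurableT_comp (mc k) measurable_fst).
    under eq_fun do rewrite col_mxEd.
    exact: (measurableT_comp (mc k) measurable_snd).
  rewrite -(splitK i); case: fintype.split => k /=.
    under [X in EFin \o X]eq_fun do rewrite col_mxEu.
    have [mk ik] := mu2 k.
    by have [] := t1 (fun x => colv x k 0 ^+ 2) (measurable_funX 2 mk) ik.
  under [X in EFin \o X]eq_fun do rewrite col_mxEd.
  have [mk ik] := nu2 k.
  by have [] := t2 (fun x => colv x k 0 ^+ 2) (measurable_funX 2 mk) ik.
split => //.
- apply/matrixP => i j; rewrite ord1 mxE.
  rewrite -(splitK i); case: fintype.split => k /=.
    under eq_Rintegral do rewrite col_mxEu.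
    rewrite col_mxEu -[in RHS](mean_gaussian psdS0 hmu) mxE.
    have [mk _] := mu2 k.
    by have [] := t1 (fun x => colv x k 0) mk (integrable_coord mu2 k).
  under eq_Rintegral do rewrite col_mxEd.
  rewrite col_mxEd -[in RHS](mean_gaussian psdS1 hnu) mxE.
  have [mk _] := nu2 k.
  by have [] := t2 (fun x => colv x k 0) mk (integrable_coord nu2 k).
- rewrite -(moment_mx_gaussian psdS0 hmu); apply/matrixP => i j.
  rewrite [LHS]mxE [LHS]mxE !moment_mxE.
  under eq_Rintegral do rewrite !col_mxEu.
  have mij := measurable_funM (mc i) (mc j).
  by have [] := t1 (fun x => colv x i 0 * colv x j 0) mij (integrable_coord_mul mu2 i j).
- rewrite -(moment_mx_gaussian psdS1 hnu); apply/matrixP => i j.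
  rewrite [LHS]mxE [LHS]mxE !moment_mxE.
  under eq_Rintegral do rewrite !col_mxEd.
  have mij := measurable_funM (mc i) (mc j).
  by have [] := t2 (fun x => colv x i 0 * colv x j 0) mij (integrable_coord_mul nu2 i j).
Qed.

(** The cross-covariance of a coupling is admissible: together with the two
    marginal covariances it forms the covariance of the pair. *)
Lemma coupling_displacement pi : couplings mu nu pi ->
  exists2 K, psd (block_mx S0 K K^T S1) & displacement_mx pi = cost_mx K.
Proof.
move=> /coupling_marginals[J2 meanE ulE drE].
have := psd_covariance J2; rewrite meanE.
set M := moment_mx pi joint_vec in ulE drE *.
set m := col_mx m0 m1 => psdC.
pose K := ursubmx M - m0 *m m1^T.
have CE : M - m *m m^T = block_mx S0 K K^T S1.
  rewrite -[M in LHS]submxK /m tr_col_mx mul_col_row opp_block_mx add_block_mx.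
  rewrite ulE drE !addrK; congr block_mx.
  rewrite /K linearB/= trmx_mul trmxK; congr (_ - _).
  by rewrite trmx_ursub [M^T]moment_mx_sym.
exists K; first by rewrite -CE.
by rewrite displacement_mxE// -/M -(subrK (m *m m^T) M) CE difference_block.
Qed.

(** The coupling is the law of the two halves of a Gaussian vector with the
    prescribed block covariance. Its marginals are Gaussian with the parameters
    of [mu] and [nu], hence equal to them by [gaussian_unique]. *)
Lemma displacement_coupling K : psd (block_mx S0 K K^T S1) ->
  exists2 pi, couplings mu nu pi & displacement_mx pi = cost_mx K.
Proof.
move=> psdG; have [rho hrho] := gaussian_exists (col_mx m0 m1) psdG.
have mf1 := measurable_linear_image (fst_mx R d).
have mf2 := measurable_linear_image (snd_mx R d).
pose f x := (vec_of (fst_mx R d *m colv x), vec_of (snd_mx R d *m colv x)).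
have mf : measurable_fun [set: vecspace R (d + d)] f.
  exact: measurable_fun_pair.
pose pi := image_prob mf rho.
have cpi : couplings mu nu pi.
  have psd1 : psd (fst_mx R d *m block_mx S0 K K^T S1 *m (fst_mx R d)^T).
    by rewrite fst_block.
  have psd2 : psd (snd_mx R d *m block_mx S0 K K^T S1 *m (snd_mx R d)^T).
    by rewrite snd_block.
  have g1 := gaussian_linear_image psdG psd1 hrho.
  have g2 := gaussian_linear_image psdG psd2 hrho.
  rewrite fst_block fst_mxE in g1; rewrite snd_block snd_mxE in g2.
  split => A mA; first exact: (gaussian_unique psdS0 g1 hmu mA).
  exact: (gaussian_unique psdS1 g2 hnu mA).
exists pi => //; have [J2 _ _ _] := coupling_marginals cpi.
rewrite displacement_mxE// /cost_mx -difference_block.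
congr (_ *m _ *m _); rewrite -(moment_mx_gaussian psdG hrho).
have rho2 := square_integrable_gaussian psdG hrho.
apply/matrixP => i j; rewrite !moment_mxE.
have fE x : joint_vec (f x) = colv x.
  rewrite /joint_vec !vec_ofK -mul_col_mx.
  suff -> : col_mx (fst_mx R d) (snd_mx R d) = 1%:M by rewrite mul1mx.
  by rewrite [RHS]scalar_mx_block.
have [mi _] := J2 i; have [mj _] := J2 j.
rewrite (@Rintegral_image_prob _ _ _ _ _ _ mf rho
  (fun z => joint_vec z i 0 * joint_vec z j 0)).
- by apply: eq_Rintegral => x _; rewrite fE.
- exact: measurable_funM.
- rewrite (_ : _ \o f = fun x => colv x i 0 * colv x j 0); last first.
    by apply/funext => x; rewrite /= fE.
  exact: integrable_coord_mul.
Qed.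

End Couplings.

Theorem proposition3p4 (R : realType) (d : nat) (gamma : 'M[R]_d -> R)
    (hgamma : psd_restriction_of_norm gamma)
    (mu nu : probability (vecspace R d) R)
    (m0 m1 : 'cV[R]_d) (Sigma0 Sigma1 : 'M[R]_d)
    (hSigma0 : psd Sigma0) (hSigma1 : psd Sigma1)
    (hmu : gaussian mu m0 Sigma0) (hnu : gaussian nu m1 Sigma1) :
  spectralW gamma mu nu ^+ 2 =
  inf [set gamma ((m1 - m0) *m (m1 - m0)^T + Sigma0 + Sigma1 - K - K^T)
      | K in [set K : 'M[R]_d | psd (block_mx Sigma0 K K^T Sigma1)]].
Proof.
rewrite /spectralW.
set A := [set gamma (displacement_mx pi) | pi in _].
set B := [set gamma _ | K in _].
have AB : A = B.
  apply/seteqP; split => x [].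
    move=> pi /(coupling_displacement hSigma0 hSigma1 hmu hnu)[K psdK e] ex.
    by exists K => //; rewrite -ex e.
  move=> K /(displacement_coupling hSigma0 hSigma1 hmu hnu)[pi cpi e] ex.
  by exists pi => //; rewrite -ex e.
rewrite -AB sqr_sqrtr//.
have [->|/set0P A0] := eqVneq A set0; first by rewrite inf0.
apply: lb_le_inf => //; move=> x [pi cpi ex]; rewrite -{x}ex.
have [N [ND NZ _] gN] := hgamma.
have [J2 _ _ _] := coupling_marginals hSigma0 hSigma1 hmu hnu cpi.
have psdD : psd (displacement_mx pi).
  rewrite displacement_mxE// -moment_mx_mulmx//.
  by apply: psd_moment_mx; exact: square_integrable_mulmx.
rewrite gN//; have [sD _] := psdD; set D := displacement_mx pi in sD *.
have sND : (- 1 *: D)^T = - 1 *: D by rewrite linearZ/= sD.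
have N0 : N 0 = 0 by rewrite -(scale0r (0 : 'M[R]_d)) NZ ?trmx0// normr0 mul0r.
have := ND _ _ sD sND; rewrite NZ// scaleN1r subrr N0 normrN1 mul1r.
by lra.
Qed.
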